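(* Let $r\ge3$ be an integer, let $\xi>0$ be real, and let $\alpha_1,\dots,\alpha_r$ be real numbers with $\alpha_1,\alpha_2>0$ and $$\alpha_{j+2}\ \ge\ [(j+2)!-1]\sum_{i=1}^{j+1}\alpha_i\qquad\text{for } j=1,2,\dots,r-2 .$$ Then there exists $n_0$ such that for every integer $n\ge n_0$ the following holds: if $N$ is an integer with $N\ge\big(\sum_{i=1}^r\alpha_i+(r+2)\,r!\,\xi\big)n$, then every $r$-edge coloring (with colors $1,\dots,r$) of the complete bipartite graph $K_{N,N}$ contains, for some $1\le i\le r$, a monochromatic copy of $C_{2\lfloor\alpha_i n\rfloor}$ in color $i$.
   Context: $C_m$ denotes the cycle of length $m$. An $r$-edge coloring of a graph is an arbitrary assignment of one of the colors $1,\dots,r$ to each edge. Copies are (not necessarily induced) subgraphs. *)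

(* Defs.v *)
From mathcomp Require Import all_boot.
Set Implicit Arguments.
Unset Strict Implicit.
Unset Printing Implicit Defensive.

Record sgraph := SGraph {
  vertex :> finType;
  adj : rel vertex;
  adj_sym : symmetric adj;
  adj_irr : irreflexive adj }.

Definition edges (G : sgraph) : {set {set G}} :=
  [set e : {set G} | [exists x : G, exists y : G,
     adj x y && (e == [set x; y])]].

Definition Knn_adj (N : nat) : rel ('I_N + 'I_N) := fun x y =>
  match x, y with
  | inl _, inr _ | inr _, inl _ => true
  | _, _ => false
  end.

Lemma Knn_adj_sym N : symmetric (@Knn_adj N).
Proof. by case=> ? []. Qed.

Lemma Knn_adj_irr N : irreflexive (@Knn_adj N).
Proof. by case. Qed.

Definition Knn (N : nat) : sgraph := SGraph (@Knn_adj_sym N) (@Knn_adj_irr N).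

Definition Cycle_adj (m : nat) : rel 'I_m := fun i j =>
  (i != j) && ((ordS i == j) || (ordS j == i)).

Lemma Cycle_adj_sym m : symmetric (@Cycle_adj m).
Proof. by move=> i j; rewrite /Cycle_adj eq_sym orbC. Qed.

Lemma Cycle_adj_irr m : irreflexive (@Cycle_adj m).
Proof. by move=> i; rewrite /Cycle_adj eqxx. Qed.

(* This is a cycle only for m >= 3 (for m = 2 it is a single edge). *)
Definition Cycle (m : nat) : sgraph :=
  SGraph (@Cycle_adj_sym m) (@Cycle_adj_irr m).

(* Colors are the numbers 1, ..., r; the value of c outside edges G is
   irrelevant. *)
Definition edge_coloring (r : nat) (G : sgraph) (c : {set G} -> nat) : Prop :=
  forall e : {set G}, e \in edges G -> (1 <= c e <= r)%N.

Definition mono_copy (H G : sgraph) (c : {set G} -> nat) (k : nat) : Prop :=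
  exists f : H -> G, injective f /\
    forall x y : H, adj x y -> adj (f x) (f y) /\ c [set f x; f y] = k.

Definition has_mono_cycle (m : nat) (G : sgraph) (c : {set G} -> nat) (k : nat)
    : Prop :=
  (3 <= m)%N /\ mono_copy (Cycle m) c k.

(* Main.v *)
Require Import Defs.
From HB Require Import structures.
From mathcomp Require Import all_boot all_order all_algebra.
From mathcomp Require Import reals zify lra.

(** Weak regularity: refine partitions of the two sides until almost every pair
of clusters (V, W) has a colour c whose density on all large subpairs A, B is
bounded below.  The function (|A||B| - D e_c(A, B))^+, summed over cells and
colours, does not decrease under refinement; on a bad pair it vanishes for the
most frequent colour c, while a sparse subpair makes it positive afterwards.
Hence boundedly many refinements suffice.

Recolour an edge by the good colour of its cluster pair, 0 meaning "missing".
If the subgraph of the last colour k has no s x s hole, with s below a third of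
the number of vertices, then one component misses fewer than s vertices on each
side, and by König's theorem it contains a matching of size N - s; a hole is a
smaller instance without colour k.  The growth of the alpha_i gives N >= 3 s.
Two almost complete colours are treated directly: if both graphs split into two
large parts, then X and Y are cut into four monochromatic blocks.

A matching inside one component of the cluster graph gives a closed walk of any
prescribed even length up to twice its size that leaves room in each cluster:
go once around the component and traverse every cluster pair back and forth as
often as the matching demands.  Such a walk is followed greedily in the graph. *)

Set Implicit Arguments.
Unset Strict Implicit.
Unset Printing Implicit Defensive.

(** * König's theorem *)

(** Submodular count for [konig]: two covers of total size at most [2 m] cannot have sizes at least
    [m] and above [m]. *)
Fact konig_count (a b a' b' k1 k2 j1 j2 j2' m m1 : nat) :
  k1 + k2 = m -> j1 + j2 <= m1 -> m1 < m -> m <= a + b -> m <= a' + b' ->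
  ~ (a + b == m) -> j2' <= j2.+1 -> b + b' = k2 + j2' -> a' + a = k1 + j1 ->
  False.
Proof. lia. Qed.

Section Konig.
Variables (L R : finType) (g : L -> R -> bool).

Definition matching (M : {set L * R}) :=
  {in M &, injective fst} /\ {in M &, injective snd}.

Definition covers (X : {set L}) (Y : {set R}) (K : {set L} * {set R}) :=
  [forall u in X, forall v in Y, g u v ==> ((u \in K.1) || (v \in K.2))].

Lemma coversP (X : {set L}) (Y : {set R}) (K : {set L} * {set R}) :
  reflect (forall u v, u \in X -> v \in Y -> g u v -> (u \in K.1) || (v \in K.2))
    (covers X Y K).
Proof.
apply: (iffP forall_inP) => [H u v uX vY guv | H u uX].
  by move/forall_inP: (H _ uX) => /(_ _ vY) /implyP; apply.
by apply/forall_inP => v vY; apply/implyP; apply: H.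
Qed.

Lemma matchingU1 M u v :
    matching M -> (forall p, p \in M -> p.1 != u /\ p.2 != v) ->
  matching ((u, v) |: M) /\ #|(u, v) |: M| = #|M|.+1.
Proof.
case=> i1 i2 H; split; last first.
  by rewrite cardsU1; case: (boolP (_ \in M)) => [/H[/eqP]|].
split=> p q /setU1P[->|pM] /setU1P[->|qM] //= E; try exact: i1; try exact: i2.
- by case: (H _ qM) => /eqP; rewrite -E.
- by case: (H _ pM) => /eqP; rewrite E.
- by case: (H _ qM) => _ /eqP; rewrite -E.
- by case: (H _ pM) => _ /eqP; rewrite E.
Qed.

(* Covers form a lattice, so a minimum cover (K1, K2) of the graph without u can
   be taken with K2 maximal; an edge uv with v outside K2 then extends a matching
   avoiding v. *)
Theorem konig (X : {set L}) (Y : {set R}) :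
  exists M K, [/\ matching M,
    forall p, p \in M -> [/\ p.1 \in X, p.2 \in Y & g p.1 p.2],
    covers X Y K & #|K.1| + #|K.2| <= #|M|].
Proof.
elim: {X}_.+1 {-2}X (ltnSn #|X|) Y => // n IH X leX Y.
have [->|[u uX]] := set_0Vmem X.
  exists set0, (set0, set0); split => /=.
  - by split=> p q; rewrite inE.
  - by move=> p; rewrite inE.
  - by apply/coversP=> a b; rewrite inE.
  - by rewrite !cards0.
have ltX : #|X :\ u| < n by move: leX; rewrite (cardsD1 u X) uX; lia.
have [M [K0 [mM inM cK0 sK0]]] := IH _ ltX Y.
(* Weak duality: distinct edges of [M] are covered by distinct vertices. *)
have lbM (K : {set L} * {set R}) : covers (X :\ u) Y K -> #|M| <= #|K.1| + #|K.2|.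
  move=> /coversP cK; case: mM => i1 i2.
  have -> : M = [set p in M | p.1 \in K.1] :|: [set p in M | p.2 \in K.2].
    apply/setP=> p; rewrite !inE -andb_orr.
    by case: (boolP (p \in M)) => //= /inM[pX pY /cK]; move/(_ pX pY)->.
  apply: leq_trans (leq_card_setU _ _) _; apply: leq_add.
    rewrite -(@card_in_imset _ _ fst); last first.
      by move=> p q; rewrite !inE => /andP[pM _] /andP[qM _]; apply: i1.
    by apply/subset_leq_card/subsetP=> _ /imsetP[p /[!inE]/andP[_ ?] ->].
  rewrite -(@card_in_imset _ _ snd); last first.
    by move=> p q; rewrite !inE => /andP[pM _] /andP[qM _]; apply: i2.
  by apply/subset_leq_card/subsetP=> _ /imsetP[p /[!inE]/andP[_ ?] ->].
pose good (K : {set L} * {set R}) := covers (X :\ u) Y K && (#|K.1| + #|K.2| == #|M|).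
have gK0 : good K0 by rewrite /good cK0 eqn_leq sK0 lbM.
case: (arg_maxnP (fun K : {set L} * {set R} => #|K.2|) gK0) => K /andP[/coversP cK /eqP sK] maxK.
(* If all neighbours of [u] lie in [K.2], then [K] still covers once [u] is restored, and [M] need
   not grow. *)
have [Nu|/forall_inPn[v vY]] := boolP [forall v in Y, g u v ==> (v \in K.2)].
  exists M, K; split; rewrite ?sK //.
    by move=> p /inM[]; rewrite inE => /andP[].
  apply/coversP=> a b aX bY gab.
  have [eq_au|au] := eqVneq a u.
    by move/forall_inP: Nu => /(_ _ bY)/implyP->; rewrite ?orbT // -eq_au.
  by apply: cK => //; rewrite !inE au.
rewrite negb_imply => /andP[guv vK].
have [M1 [J [mM1 inM1 cJ sJ]]] := IH _ ltX (Y :\ v).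
(* If removing [v] lowered the matching number, [J] with [v] added would cover with at most [#|M|]
   vertices. Combining it with [K] gives a minimum cover whose right part also contains [v], against
   the choice of [K]. *)
have leM : #|M| <= #|M1|.
  rewrite leqNgt; apply/negP => ltM.
  have cJv : covers (X :\ u) Y (J.1, v |: J.2).
    apply/coversP=> a b aX bY gab /=; rewrite !inE.
    have [//|bv] := eqVneq b v; first by rewrite orbT.
    by move/coversP: cJ; apply => //; rewrite !inE bv.
  have := lbM (K.1 :|: J.1, K.2 :&: (v |: J.2)).
  have := maxK (K.1 :&: J.1, K.2 :|: (v |: J.2)).
  have := lbM (K.1 :&: J.1, K.2 :|: (v |: J.2)).
  have c1 : covers (X :\ u) Y (K.1 :&: J.1, K.2 :|: (v |: J.2)).
    apply/coversP=> a b aX bY gab /=; move: (cK _ _ aX bY gab).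
    by move/coversP: cJv => /(_ _ _ aX bY gab) /=; rewrite !inE; do ?case: (_ \in _); rewrite ?orbT.
  have c2 : covers (X :\ u) Y (K.1 :|: J.1, K.2 :&: (v |: J.2)).
    apply/coversP=> a b aX bY gab /=; move: (cK _ _ aX bY gab).
    by move/coversP: cJv => /(_ _ _ aX bY gab) /=; rewrite !inE; do ?case: (_ \in _); rewrite ?orbT //= ?andbT ?orbF.
  rewrite /good c1 c2 /= => /(_ isT) A1 B1 /(_ isT) A2.
  have := cardsUI K.1 J.1; have := cardsUI K.2 (v |: J.2).
  have vKJ : #|K.2| < #|K.2 :|: (v |: J.2)|.
    apply: proper_card; apply/properP; split; first exact: subsetUl.
    by exists v => //; rewrite !inE eqxx orbT.
  have : #|v |: J.2| <= #|J.2|.+1 by rewrite cardsU1 -add1n leq_add2r leq_b1.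
  have : ~ (#|K.1 :&: J.1| + #|K.2 :|: (v |: J.2)| == #|M|).
    by move/B1; rewrite leqNgt vKJ.
  by move: sK sJ ltM A1 A2; apply: konig_count.
have [|mM2 cM2] := @matchingU1 M1 u v mM1.
  by move=> p /inM1[]; rewrite !inE => /andP[? _] /andP[? _].
exists ((u, v) |: M1), (u |: K.1, K.2); split => //=.
- by move=> p /setU1P[->//|/inM1[]]; rewrite !inE => /andP[_ ?] /andP[_ ?].
- apply/coversP=> a b aX bY gab /=; rewrite inE.
  have [->|au] := eqVneq a u; first by rewrite inE eqxx.
  have := cK a b; rewrite !inE au aX => /(_ isT bY gab) /orP[->|->]; by rewrite ?orbT.
- by rewrite cM2 cardsU1 -addnA sK -add1n leq_add // leq_b1.
Qed.
End Konig.

(** * Weak regularity *)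

Section Density.
Variables (L R : finType) (col : L -> R -> nat) (D : nat).
Implicit Types (A : {set L}) (B : {set R}).

Definition ecount c A B := \sum_(u in A) \sum_(v in B) (col u v == c).

(* Truncated subtraction: this is the positive part of |A||B| - D e_c(A, B), which
   is superadditive over the cells of a partition (deficit_cells). *)
Definition deficit c A B := #|A| * #|B| - D * ecount c A B.

(** One-sided regularity: the greedy embedding needs only a lower bound on density. For positive [K]
    the strict inequality excludes colours absent from the pair. *)
Definition lreg K c A B :=
  [forall A' : {set L}, forall B' : {set R},
    [&& A' \subset A, B' \subset B, #|A| <= K * #|A'| & #|B| <= K * #|B'|] ==>
    (#|A'| * #|B'| < 2 * D * ecount c A' B')].

(** Where regularity fails, [D e_c] is at most half of [|A'||B'|], so the deficit is at least the
    other half. *)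
Lemma lregPn K c A B :
  ~~ lreg K c A B ->
  exists A' B', [/\ A' \subset A, B' \subset B, #|A| * #|B| <= K ^ 2 * (#|A'| * #|B'|)
    & #|A'| * #|B'| <= 2 * deficit c A' B'].
Proof.
case/forallPn=> A' /forallPn[B']; rewrite negb_imply -leqNgt.
case/andP=> /and4P[sA sB lA lB] le; exists A', B'; split => //.
  by have := leq_mul lA lB; rewrite mulnACA.
move: le; rewrite /deficit -mulnA.
by move: (#|A'| * #|B'|) (D * _) => a e; clear; lia.
Qed.

Lemma cells_sum (I : finType) (V : finType) (P : V -> I) (S : {set I}) (F : V -> nat) :
  \sum_(u in P @^-1: S) F u = \sum_(i in S) \sum_(u in P @^-1: [set i]) F u.
Proof.
rewrite (partition_big P (mem S)) /=; last by move=> u; rewrite inE.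
apply: eq_bigr => i iS; apply: eq_bigl => u; rewrite !inE.
by case: eqP => [->|]; rewrite ?andbT ?andbF.
Qed.

Lemma card_cells (I V : finType) (P : V -> I) :
  #|V| = \sum_i #|P @^-1: [set i]|.
Proof.
rewrite -cardsT (_ : [set: V] = P @^-1: setT); last by apply/setP => u; rewrite !inE.
rewrite -sum1_card cells_sum /=.
by apply: eq_big => [i|i _]; rewrite ?inE // sum1_card.
Qed.

(** Before truncation the difference is additive over cells, and truncating every summand at 0 can
    only increase the sum. *)
Lemma deficit_cells (I J : finType) (P : L -> I) (Q : R -> J) (S : {set I})
    (S' : {set J}) c :
  deficit c (P @^-1: S) (Q @^-1: S') <=
  \sum_(i in S) \sum_(j in S') deficit c (P @^-1: [set i]) (Q @^-1: [set j]).
Proof.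
have sumB (K : finType) (X : {set K}) (f g : K -> nat) :
    \sum_(i in X) f i - \sum_(i in X) g i <= \sum_(i in X) (f i - g i).
  rewrite leq_subLR -big_split /=; apply: leq_sum => i _; lia.
have -> : deficit c (P @^-1: S) (Q @^-1: S') =
    \sum_(i in S) \sum_(j in S') #|P @^-1: [set i]| * #|Q @^-1: [set j]| -
    \sum_(i in S) \sum_(j in S') D * ecount c (P @^-1: [set i]) (Q @^-1: [set j]).
  congr (_ - _).
    rewrite -!sum1_card !cells_sum big_distrl; apply: eq_bigr => i _.
    by rewrite big_distrr; apply: eq_bigr => j _; rewrite -!sum1_card.
  rewrite /ecount cells_sum big_distrr; apply: eq_bigr => i _.
  rewrite -big_distrr; congr (_ * _); rewrite exchange_big /=.
  by under [RHS]eq_bigr do rewrite exchange_big; rewrite cells_sum.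
apply: leq_trans (sumB _ _ _ _) _; apply: leq_sum => i _.
exact: sumB.
Qed.

(** The counts of the [D] colours add up to [|A||B|], so the most frequent colour reaches the
    average. *)
Lemma popular_color A B : 0 < D -> (forall u v, col u v < D) ->
  exists c : 'I_D, deficit c A B = 0.
Proof.
move=> D0 ltD.
have tot : \sum_(c < D) ecount c A B = #|A| * #|B|.
  rewrite exchange_big -sum_nat_const; apply: eq_bigr => u _ /=.
  rewrite exchange_big -[RHS]muln1 -sum_nat_const; apply: eq_bigr => v _ /=.
  rewrite (bigD1 (Ordinal (ltD u v))) //= eqxx big1 ?addn0 // => c.
  by rewrite -val_eqE /= eq_sym => /negPf->.
case: (@arg_maxnP _ (Ordinal D0) xpredT (fun c : 'I_D => ecount c A B) isT) => c _ cmax.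
exists c; apply/eqP; rewrite subn_eq0 -tot.
by rewrite -[X in X * _]card_ord -sum_nat_const; apply: leq_sum => c' _; apply: cmax.
Qed.

End Density.

Section Regularity.
Variables (D K : nat).

Definition good_pair (L R : finType) (col : L -> R -> nat) A B :=
  [exists c : 'I_D, lreg col D K c A B].

Definition potential (L R I J : finType) (col : L -> R -> nat)
    (P : L -> I) (Q : R -> J) :=
  \sum_(i : I) \sum_(j : J) \sum_(c < D)
    deficit col D c (P @^-1: [set i]) (Q @^-1: [set j]).

Definition bad_weight (L R I J : finType) (col : L -> R -> nat)
    (P : L -> I) (Q : R -> J) :=
  \sum_(i : I) \sum_(j : J | ~~ good_pair col (P @^-1: [set i]) (Q @^-1: [set j]))
    #|P @^-1: [set i]| * #|Q @^-1: [set j]|.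

Lemma potential_le (L R I J : finType) (col : L -> R -> nat) (P : L -> I) (Q : R -> J) :
  potential col P Q <= D * (#|L| * #|R|).
Proof.
rewrite /potential; have -> : D * (#|L| * #|R|) =
    \sum_i \sum_j D * (#|P @^-1: [set i]| * #|Q @^-1: [set j]|).
  rewrite (card_cells P) (card_cells Q) big_distrlr big_distrr /=.
  by apply: eq_bigr => i _; rewrite big_distrr.
apply: leq_sum => i _.
apply: leq_sum => j _; set m := #|_| * #|_|.
have <- : \sum_(c < D) m = D * m by rewrite sum_nat_const card_ord.
by apply: leq_sum => c _; apply: leq_subr.
Qed.

(** The new label of a vertex records its old cell and the opposite cells for which it lies in the
    witness of irregularity. On a bad pair the popular colour contributed 0 before, and afterwards
    at least a [1 / (2 K^2)] share of the weight of the pair. *)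
Lemma refine_potential (L R I J : finType) (col : L -> R -> nat)
    (P : L -> I) (Q : R -> J) : 0 < D -> (forall u v, col u v < D) ->
  exists (P' : L -> I * {set J}) (Q' : R -> J * {set I}),
    2 * K ^ 2 * potential col P Q + bad_weight col P Q <=
    2 * K ^ 2 * potential col P' Q'.
Proof.
move=> D0 ltD; pose V i := P @^-1: [set i]; pose W j := Q @^-1: [set j].
have wit i j : exists AB : {set L} * {set R}, ~~ good_pair col (V i) (W j) ->
    [/\ AB.1 \subset V i, AB.2 \subset W j &
     exists c : 'I_D, deficit col D c (V i) (W j) = 0 /\
       #|V i| * #|W j| <= 2 * K ^ 2 * deficit col D c AB.1 AB.2].
  case: (boolP (good_pair _ _ _)) => [_|bad]; first by exists (set0, set0).
  have [c c0] := popular_color (V i) (W j) D0 ltD.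
  case/existsPn/(_ c)/lregPn: bad => A' [B' [sA sB lK le2]].
  exists (A', B') => _; split => //; exists c; split => //.
  by apply: leq_trans lK _; rewrite (mulnC 2) -mulnA leq_mul2l le2 orbT.
have [F FP] := fin_all_exists (fun i => fin_all_exists (wit i)).
pose P' u := (P u, [set j | u \in (F (P u) j).1]).
pose Q' v := (Q v, [set i | v \in (F i (Q v)).2]).
exists P', Q'.
pose SI i := [set p : I * {set J} | p.1 == i].
pose SJ j := [set q : J * {set I} | q.1 == j].
pose d c p q := deficit col D c (P' @^-1: [set p]) (Q' @^-1: [set q]).
have -> : potential col P' Q' =
    \sum_i \sum_j \sum_(c < D) \sum_(p in SI i) \sum_(q in SJ j) d c p q.
  have pairE (T U : finType) (G : T * U -> nat) :
      \sum_p G p = \sum_t \sum_(p in [set p | p.1 == t]) G p.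
    rewrite (partition_big fst predT) //.
    by apply: eq_bigr => t _; apply: eq_bigl => p; rewrite inE.
  rewrite /potential pairE; apply: eq_bigr => i _.
  under eq_bigr do rewrite pairE.
  rewrite exchange_big; apply: eq_bigr => j _ /=.
  under eq_bigr do rewrite exchange_big /=.
  by rewrite exchange_big.
rewrite /potential /bad_weight big_distrr -big_split big_distrr /=.
apply: leq_sum => i _; rewrite [X in _ + X]big_mkcond big_distrr -big_split big_distrr /=.
apply: leq_sum => j _.
have mono (c : 'I_D) : deficit col D c (V i) (W j) <= \sum_(p in SI i) \sum_(q in SJ j) d c p q.
  have -> : V i = P' @^-1: (SI i) by apply/setP=> u; rewrite !inE.
  have -> : W j = Q' @^-1: (SJ j) by apply/setP=> u; rewrite !inE.
  exact: deficit_cells.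
case: ifPn => [bad|_]; last by rewrite addn0 leq_mul2l leq_sum ?orbT.
have [sA sB [c [dc0 gain]]] := FP i j bad.
rewrite (bigD1 c) //= dc0 add0n [X in _ <= _ * X](bigD1 c) //= mulnDr addnC leq_add //; last first.
  by rewrite leq_mul2l leq_sum ?orbT.
apply: leq_trans gain _; rewrite leq_mul2l; apply/orP; right.
(* The witness sets are unions of new cells, so [deficit_cells] applies to them. *)
have -> : (F i j).1 = P' @^-1: [set p in SI i | j \in p.2].
  apply/setP=> u; rewrite !inE /=; apply/idP/andP => [uF|[/eqP <-]//].
  by move/subsetP: sA => /(_ _ uF); rewrite !inE => /eqP ->.
have -> : (F i j).2 = Q' @^-1: [set q in SJ j | i \in q.2].
  apply/setP=> u; rewrite !inE /=; apply/idP/andP => [uF|[/eqP <-]//].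
  by move/subsetP: sB => /(_ _ uF); rewrite !inE => /eqP ->.
apply: leq_trans (deficit_cells _ _ _ _ _ _ _) _.
have sub (T : finType) (X Y : {set T}) (f g : T -> nat) : X \subset Y -> (forall x, f x <= g x) ->
    \sum_(x in X) f x <= \sum_(x in Y) g x.
  move=> sXY lefg; rewrite [X in _ <= X](big_setID X) /= (setIidPr sXY).
  by apply: leq_trans (leq_addr _ _); apply: leq_sum => x _.
have subI (T : finType) (X : {set T}) (a : pred T) : [set x in X | a x] \subset X.
  by apply/subsetP=> x; rewrite inE => /andP[].
by apply: (sub) => // p; apply: (sub).
Qed.

Theorem weak_regularity E : 0 < D -> exists T, forall (L R : finType) (col : L -> R -> nat),
  (forall u v, col u v < D) ->
  exists (I J : finType) (P : L -> I) (Q : R -> J),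
    [/\ #|I| <= T, #|J| <= T & E * bad_weight col P Q <= #|L| * #|R|].
Proof.
move=> D0.
suff iter k : exists T, forall (L R : finType) (col : L -> R -> nat),
    (forall u v, col u v < D) ->
    exists (I J : finType) (P : L -> I) (Q : R -> J),
    [/\ #|I| <= T, #|J| <= T & (E * bad_weight col P Q <= #|L| * #|R|) ||
      (k * (#|L| * #|R|).+1 <= E * (2 * K ^ 2 * potential col P Q))].
  (* Each failed round raises the scaled potential by at least [|L||R| + 1]. Since the potential is
     at most [D |L||R|], this many rounds cannot all fail. *)
  have [T HT] := iter (E * (2 * K ^ 2 * D)).+1; exists T => L R col ltD.
  have [I [J [P [Q [cI cJ /orP[bd|le]]]]]] := HT L R col ltD; exists I, J, P, Q; split => //.
  have := potential_le col P Q; move: le; set x := #|L| * #|R| => le pot.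
  have: E * (2 * K ^ 2 * potential col P Q) <= E * (2 * K ^ 2 * (D * x)).
    by rewrite !leq_mul2l pot !orbT.
  move=> /(leq_trans le); rewrite !mulnA; move: (E * 2 * K ^ 2 * D) => k; clear; nia.
elim: k => [|k [T IH]].
  exists 1 => L R col _; exists unit, unit, (fun=> tt), (fun=> tt).
  by rewrite !card_unit mul0n leq0n orbT.
exists (T * 2 ^ T) => L R col ltD.
have [I [J [P [Q [cI cJ H]]]]] := IH L R col ltD.
have [bd|nb] := boolP (E * bad_weight col P Q <= #|L| * #|R|).
  exists I, J, P, Q; rewrite bd; split => //.
    by apply: leq_trans cI _; rewrite leq_pmulr ?expn_gt0.
  by apply: leq_trans cJ _; rewrite leq_pmulr ?expn_gt0.
have cset (U : finType) : #|{set U}| = 2 ^ #|U|.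
  by rewrite -[#|U|]cardsT -card_powerset powersetT cardsT.
have [P' [Q' le]] := refine_potential P Q D0 ltD.
exists (I * {set J})%type, (J * {set I})%type, P', Q'; split.
- by rewrite card_prod cset leq_mul // leq_pexp2l.
- by rewrite card_prod cset leq_mul // leq_pexp2l.
apply/orP; right; case/orP: H => [|H]; first by rewrite (negPf nb).
move: nb; rewrite -ltnNge => nb; rewrite mulSn addnC; apply: leq_trans (leq_add H nb) _.
by rewrite -mulnDr leq_mul2l le orbT.
Qed.
End Regularity.

(** * Following a closed walk of clusters *)

Lemma exists_subset_card (T : finType) (S : {set T}) k :
  k <= #|S| -> exists2 B : {set T}, B \subset S & #|B| = k.
Proof.
move=> le; exists [set x in take k (enum S)].
  by apply/subsetP=> x; rewrite inE => /mem_take; rewrite mem_enum.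
rewrite cardsE (card_uniqP _) ?take_uniq ?enum_uniq //.
by rewrite size_takel // -cardE.
Qed.

Section Embedding.
Variables (V T : finType) (lab : V -> T) (g : rel V) (D K Q : nat).
Hypotheses (irr_g : irreflexive g) (sym_g : symmetric g).
Hypotheses (D0 : 0 < D) (Q0 : 0 < Q) (leK : 8 * D * Q <= K).

Definition cluster t := lab @^-1: [set t].

Definition nbhd (v : V) (B : {set V}) := [set x in B | g v x].

(** Density expressed through one vertex of large degree, the form in which the greedy path consumes
    it. *)
Definition lower_dense t t' := forall A B : {set V},
  A \subset cluster t -> B \subset cluster t' ->
  #|cluster t| <= K * #|A| -> #|cluster t'| <= K * #|B| ->
  exists2 a, a \in A & #|B| < 2 * D * #|nbhd a B|.

(** If the vertices of low degree made up a [1/K] share of the cluster, density applied to them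
    would be contradicted. *)
Lemma few_low_degree t t' : lower_dense t t' ->
  K * #|[set a in cluster t | 2 * D * #|nbhd a (cluster t')| <= #|cluster t'|]| <
    #|cluster t| \/ #|cluster t| = 0.
Proof.
move=> den; set S := [set a in _ | _]; case: (posnP #|cluster t|) => [->|c0]; first by right.
left; rewrite ltnNge; apply/negP => le.
have [||//||a] := den S (cluster t').
- by apply/subsetP => a; rewrite inE => /andP[].
- exact: subxx.
- by rewrite leq_pmull //; nia.
by rewrite inE => /andP[_ le1]; rewrite ltnNge le1.
Qed.

(** Each of the two sets of low degree has less than a [1/K] share, and [K >= 2], so some vertex
    avoids both. *)
Lemma first_vertex t t1 t2 : lower_dense t t1 -> lower_dense t t2 ->
  0 < #|cluster t| ->
  exists2 v, v \in cluster t &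
    #|cluster t1| < 2 * D * #|nbhd v (cluster t1)| /\
    #|cluster t2| < 2 * D * #|nbhd v (cluster t2)|.
Proof.
move=> d1 d2 c0.
case: (few_low_degree d1) => [|E]; last by rewrite E in c0.
case: (few_low_degree d2) => [|E]; last by rewrite E in c0.
set S2 := [set a in _ | _]; set S1 := [set a in _ | _] => l2 l1.
have : 0 < #|cluster t :\: (S1 :|: S2)|.
  rewrite cardsD subn_gt0; apply: leq_ltn_trans (subset_leq_card (subsetIr _ _)) _.
  apply: leq_ltn_trans (leq_card_setU _ _) _.
  have K2 : 2 <= K by nia.
  by move: l1 l2 c0 K2; move: #|S1| #|S2| #|cluster t|; clear; nia.
case/card_gt0P => v; rewrite !inE negb_or => /andP[/andP[n1 n2] vt].
by exists v; rewrite ?inE //; split; rewrite ltnNge; [move: n1|move: n2]; rewrite ?inE ?vt.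
Qed.

(* The closing vertex is secured in advance: B is a small set of neighbours of the
   first vertex v0 in the last cluster, and the greedy path avoids B. *)
Lemma embed_cycle (e : rel T) (w : seq T) :
    symmetric e -> (forall t t', e t t' -> lower_dense t t') ->
    cycle e w -> 3 <= size w ->
    (forall t, t \in w -> K <= #|cluster t| /\
       #|cluster t| <= Q * (#|cluster t| - count_mem t w)) ->
  exists p : seq V, [/\ uniq p, cycle g p & size p = size w].
Proof.
move=> sym_e den; case: w => // t0 s cyc sz big.
have sz2 : 2 <= size s by [].
pose tt k := nth t0 (t0 :: s) k.
have ett k : k < size s -> e (tt k) (tt k.+1).
  move=> lt; move/(pathP t0): cyc => /(_ k); rewrite size_rcons ltnS => /(_ (ltnW lt)).
  by rewrite -rcons_cons !nth_rcons /= lt ltnS ltnW.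
have elast : e t0 (tt (size s)).
  rewrite sym_e; move/(pathP t0): cyc => /(_ (size s)); rewrite size_rcons => /(_ (ltnSn _)).
  by rewrite -rcons_cons !nth_rcons /= ltnSn ltnn eqxx.
have ttw k : k <= size s -> tt k \in t0 :: s by move=> le; apply: mem_nth.
have bigt k : k <= size s -> K <= #|cluster (tt k)| by move=> /ttw/big[].
have K0 : 0 < K by nia.
(* The cycle leaves [v0] into the second cluster and returns from the last one, so [v0] needs many
   neighbours in both. *)
have [v0 v0t [deg1 degl]] : exists2 v, v \in cluster t0 &
    #|cluster (tt 1)| < 2 * D * #|nbhd v (cluster (tt 1))| /\
    #|cluster (tt (size s))| < 2 * D * #|nbhd v (cluster (tt (size s)))|.
  apply: first_vertex; first by apply: den; apply: (ett 0); apply: ltnW.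
    exact: den.
  by apply: leq_trans K0 _; apply: (bigt 0).
(* This size is just above [1/K] of the last cluster: density applies to [B], yet [B] takes at most
   a [2/K] share of any cluster on the walk. *)
have [B sB cB] : exists2 B : {set V}, B \subset nbhd v0 (cluster (tt (size s))) &
    #|B| = (#|cluster (tt (size s))| %/ K).+1.
  apply: exists_subset_card; have := leq_trunc_div #|cluster (tt (size s))| K.
  set c := #|cluster _|; set d := #|nbhd _ _|; set q := c %/ K => leqK.
  have leq8 : q * (8 * D) <= c by apply: leq_trans leqK; rewrite leq_mul2l; nia.
  have: (4 * q) * (2 * D) < d * (2 * D) by apply: leq_ltn_trans (_ : c < _); nia.
  by rewrite ltn_mul2r => /andP[_]; clear; lia.
have Bt x : x \in B -> lab x = tt (size s) /\ g v0 x.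
  by move/subsetP: sB => sB /sB; rewrite !inE => /andP[/eqP].
have cBt k : k <= size s -> K * #|cluster (tt k) :&: B| <= 2 * #|cluster (tt k)|.
  move=> lek; case: (eqVneq (tt k) (tt (size s))) => [->|ne].
    apply: leq_trans (_ : K * #|B| <= _); first by rewrite leq_mul2l subset_leq_card ?subsetIr ?orbT.
    rewrite cB mulnS mulnC mul2n -addnn leq_add ?leq_trunc_div //; exact: bigt.
  rewrite (_ : _ :&: _ = set0) ?cards0 ?muln0 //; apply/setP=> x; rewrite !inE.
  by apply/negP => /andP[/eqP E /Bt[E' _]]; case/eqP: ne; rewrite -E.
have lBt : #|cluster (tt (size s))| <= K * #|B|.
  by rewrite cB mulnC ltnW // ltn_ceil.
pose free q k := [set x in cluster (tt k) | [&& x \notin B & x \notin v0 :: q]].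
(* The used vertices of a cluster are at most the visits of the walk to it, so free vertices and [B]
   together keep a [1/Q] share. As [K >= 8 D Q], removing [B] leaves a share of [6 D / K]. *)
have freeK q k : k <= size s -> map lab (v0 :: q) = take (size q).+1 (t0 :: s) ->
    6 * D * #|cluster (tt k)| <= K * #|free q k|.
  move=> lek labq; have [_ bigQ] := big _ (ttw _ lek).
  have cnt : #|cluster (tt k) :&: [set x in v0 :: q]| <= count_mem (tt k) (t0 :: s).
    apply: leq_trans (_ : count_mem (tt k) (map lab (v0 :: q)) <= _); last first.
      by rewrite labq -[X in _ <= count _ X](cat_take_drop (size q).+1) count_cat leq_addr.
    rewrite count_map -size_filter; apply: leq_trans (card_size _).
    apply/subset_leq_card/subsetP=> x.
    by rewrite mem_filter /= !inE => /andP[-> ->].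
  have : #|cluster (tt k)| <= #|free q k| + (#|cluster (tt k) :&: B| +
      #|cluster (tt k) :&: [set x in v0 :: q]|).
    apply: leq_trans (leq_add (leqnn _) (leq_card_setU _ _)).
    apply: leq_trans (leq_card_setU _ _); apply/subset_leq_card/subsetP=> x.
    by rewrite !inE => ->; case: (x \in B); case: (x == v0); case: (x \in q).
  move: (cBt k lek) cnt bigQ leK D0 Q0.
  move: #|cluster _ :&: [set x in _]| #|_ :&: B| #|free q k| #|cluster _| (count _ _); clear.
  move=> u b f c ct lb lu lQ lK D0 Q0 le.
  have lf : c <= Q * (f + b) by nia.
  have: 8 * D * c <= K * (f + b) by nia.
  nia.
(* Invariant: the end of the path has a [1/K] share of free neighbours in the next cluster. Density
   towards the free part of the cluster after that selects the next vertex among them. *)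
have walk k : k < (size s).-1 -> exists q, [/\ size q = k, path g v0 q,
    uniq (v0 :: q), {in v0 :: q, forall x, x \notin B} &
    map lab (v0 :: q) = take k.+1 (t0 :: s) /\
    #|cluster (tt k.+1)| <= K * #|nbhd (last v0 q) (free q k.+1)|].
  elim: k => [|k IH] ltk.
    exists [::]; split => //.
    - by move=> x; rewrite inE => /eqP ->; apply/negP => /Bt[_]; rewrite irr_g.
    split; first by move: v0t; rewrite !inE /= => /eqP ->; rewrite take0.
    have : #|nbhd v0 (cluster (tt 1))| <= #|nbhd v0 (free [::] 1)| + #|cluster (tt 1) :&: B|.
      apply: leq_trans (leq_card_setU _ _); apply/subset_leq_card/subsetP=> x.
      rewrite !inE => /andP[-> gx]; rewrite gx; case: (x \in B) => //=.
      by rewrite orbF andbT; apply: contraTneq gx => ->; rewrite irr_g.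
    have le1 : 1 <= size s by lia.
    move: deg1 (cBt 1 le1) leK D0 Q0; rewrite /=.
    move: #|nbhd v0 (free _ _)| #|nbhd v0 (cluster _)| #|_ :&: B| #|cluster _|; clear.
    move=> d' d b c lc lb lK D0 Q0 le.
    have: 4 * c <= K * d by nia.
    nia.
  have [q [szq pq uq qB [labq degq]]] := IH (ltnW ltk).
  have ltk2 : k.+2 < (size s).+1 by move: ltk; clear; lia.
  have sA : nbhd (last v0 q) (free q k.+1) \subset cluster (tt k.+1).
    by apply/subsetP=> x; rewrite !inE => /andP[/andP[]].
  have sU : free q k.+2 \subset cluster (tt k.+2).
    by apply/subsetP=> x; rewrite !inE => /andP[].
  have frU : 6 * D * #|cluster (tt k.+2)| <= K * #|free q k.+2|.
    by apply: freeK; rewrite ?szq.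
  have lU : #|cluster (tt k.+2)| <= K * #|free q k.+2|.
    by apply: leq_trans frU; rewrite leq_pmull ?muln_gt0.
  have [v vA degv] := den _ _ (ett k.+1 ltk2) _ _ sA sU degq lU.
  move: vA; rewrite !inE => /andP[/and3P[/eqP labv vB vq] gv].
  exists (rcons q v); split.
  - by rewrite size_rcons szq.
  - by rewrite rcons_path pq.
  - by rewrite -rcons_cons rcons_uniq uq inE vq.
  - by move=> x; rewrite -rcons_cons mem_rcons inE => /predU1P[->|/qB].
  split.
    by rewrite -rcons_cons map_rcons labq labv [RHS](take_nth t0) //; apply: ltnW.
  rewrite last_rcons.
  have sub : nbhd v (free q k.+2) \subset nbhd v (free (rcons q v) k.+2).
    apply/subsetP=> x; rewrite !inE => /andP[/and3P[-> -> nx] gx].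
    rewrite gx mem_rcons inE; move: nx; rewrite !negb_or => /andP[-> ->]; rewrite !andbT /=.
    by apply: contraTneq gx => ->; rewrite irr_g.
  have := leq_mul (leqnn K) (subset_leq_card sub); apply: leq_trans.
  move: frU degv D0; move: #|nbhd _ _| #|free _ _| #|cluster _|; clear; nia.
have [q [szq pq uq qB [labq degq]]] : exists q, [/\ size q = (size s).-2, path g v0 q,
    uniq (v0 :: q), {in v0 :: q, forall x, x \notin B} &
    map lab (v0 :: q) = take (size s).-1 (t0 :: s) /\
    #|cluster (tt (size s).-1)| <= K * #|nbhd (last v0 q) (free q (size s).-1)|].
  have E : (size s).-2.+1 = (size s).-1 by move: sz => /=; lia.
  by have := walk (size s).-2; rewrite E; apply; lia.
have E : (size s).-1.+1 = size s by rewrite prednK // ltnW.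
have sA : nbhd (last v0 q) (free q (size s).-1) \subset cluster (tt (size s).-1).
  by apply/subsetP=> x; rewrite !inE => /andP[/andP[]].
have sB' : B \subset cluster (tt (size s)).
  by apply/subsetP=> x /Bt[/eqP]; rewrite !inE.
have esl : e (tt (size s).-1) (tt (size s)) by rewrite -[in tt (size s)]E; apply: ett; rewrite E.
(* Density towards [B] supplies the last two vertices; the second lies in [B] and hence closes the
   cycle at [v0]. *)
have [a aA degb] := den _ _ esl _ _ sA sB' degq lBt.
have /card_gt0P[b] : 0 < #|nbhd a B| by move: degb; case: #|nbhd a B|; rewrite ?muln0.
rewrite inE => /andP[bB gab]; have [_ gvb] := Bt _ bB.
move: aA; rewrite !inE => /andP[/and3P[_ aB aq] ga].
exists (v0 :: rcons (rcons q a) b); split.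
- have ba : b != a by apply: contraNneq aB => <-.
  have bq : b \notin v0 :: q by apply: contraL bB => /qB.
  have aq' : a \notin v0 :: q by rewrite inE.
  by rewrite -!rcons_cons !rcons_uniq uq aq' mem_rcons in_cons negb_or ba bq.
- by rewrite /= !rcons_path pq !last_rcons ga gab sym_g.
- by rewrite /= !size_rcons szq /=; move: sz2; clear; lia.
Qed.
End Embedding.

(** * Matchings inside one class *)

(** Adding a further element to a largest set with property [P] destroys [P]. *)
Lemma exists_first_failure (T : finType) (P : pred {set T}) :
  P set0 -> ~~ P setT -> exists U t, P U /\ ~~ P (t |: U).
Proof.
move=> P0 PT; case: (arg_maxnP (fun U : {set T} => #|U|) P0) => U PU maxU.
have [t tU] : exists t, t \notin U.
  apply/existsP; apply: contraR PT => /existsPn H.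
  by rewrite (_ : setT = U) //; apply/setP=> t; rewrite inE; have := H t; rewrite negbK.
exists U, t; split => //; apply/negP => /maxU.
by rewrite cardsU1 tU /= add1n ltnn.
Qed.

Section Ramsey.
Variables (L R T : finType) (col : L -> R -> nat).
(* kL k and kR k name the component of a vertex in colour k; colour 0 stands for a
   missing edge. *)
Variables (kL : nat -> L -> T) (kR : nat -> R -> T).
Hypothesis col_class : forall k u v, col u v = k -> 0 < k -> kL k u = kR k v.
Implicit Types (X : {set L}) (Y : {set R}).

(** The common label [t] places the matching in one component, so that a single closed walk can
    traverse all of it. *)
Definition class_matching k X Y a := exists M : {set L * R},
  [/\ matching M, #|M| = a &
    exists t, forall p, p \in M ->
      [/\ p.1 \in X, p.2 \in Y, col p.1 p.2 = k & kL k p.1 = t]].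

Lemma class_matching_sub k X Y X' Y' a :
  X' \subset X -> Y' \subset Y -> class_matching k X' Y' a -> class_matching k X Y a.
Proof.
move=> /subsetP sX /subsetP sY [M [mM cM [t Ht]]]; exists M; split => //.
by exists t => p /Ht[/sX ? /sY ? ? ?].
Qed.

(** König's theorem for colour [k]: deleting a cover of fewer than [a] vertices leaves no edge of
    that colour. *)
Lemma class_konig k X Y t a :
    (forall u v, u \in X -> v \in Y -> col u v = k -> kL k u = t) ->
  class_matching k X Y a \/
  exists X' Y', [/\ X' \subset X, Y' \subset Y, (#|X :\: X'| + #|Y :\: Y'|) < a &
    forall u v, u \in X' -> v \in Y' -> col u v <> k].
Proof.
move=> Ht; have [M [K [[i1 i2] inM /coversP cK sK]]] := konig (fun u v => col u v == k) X Y.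
have [lea|lta] := leqP a #|M|.
  left; have [M' sM' cM'] := exists_subset_card lea; move/subsetP: sM' => sM'.
  exists M'; split => //.
    by split=> p q /sM' pM /sM' qM; [apply: i1|apply: i2].
  by exists t => p /sM'/inM[pX pY /eqP E]; split => //; apply: Ht pX pY E.
right; exists (X :\: K.1), (Y :\: K.2); split; rewrite ?subsetDl //.
  apply: leq_ltn_trans lta; apply: leq_trans sK.
  by rewrite !setDDr !setDv !set0U leq_add // subset_leq_card // subsetIr.
move=> u v /setDP[uX uK] /setDP[vY vK] /eqP E.
by have := cK _ _ uX vY E; rewrite (negPf uK) (negPf vK).
Qed.

Definition hole k X Y s := exists X' Y',
  [/\ X' \subset X, Y' \subset Y, s <= #|X'|, s <= #|Y'| &
    forall u v, u \in X' -> v \in Y' -> col u v <> k].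

Lemma hole_dec k X Y s : hole k X Y s \/
  forall X' Y', X' \subset X -> Y' \subset Y -> s <= #|X'| -> s <= #|Y'| ->
  exists u v, [/\ u \in X', v \in Y' & col u v = k].
Proof.
case: (boolP [exists X' : {set L}, exists Y' : {set R}, [&& X' \subset X, Y' \subset Y,
  s <= #|X'|, s <= #|Y'| & [forall u in X', forall v in Y', col u v != k]]]).
  move=> /existsP[X' /existsP[Y' /and5P[? ? ? ? /forall_inP H]]]; left.
  exists X', Y'; split => // u v /H /forall_inP/[apply] /eqP//.
move=> /existsPn H; right=> X' Y' sX sY lX lY.
move/existsPn: (H X') => /(_ Y'); rewrite sX sY lX lY /=.
move=> /forall_inPn[u uX /forall_inPn[v vY /negPn/eqP]]; by exists u, v.
Qed.

Definition partL k X (U : {set T}) := [set u in X | kL k u \in U].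
Definition partR k Y (U : {set T}) := [set v in Y | kR k v \in U].

Lemma partL_sub k X U : partL k X U \subset X.
Proof. by apply/subsetP=> u; rewrite inE => /andP[]. Qed.

Lemma partR_sub k Y U : partR k Y U \subset Y.
Proof. by apply/subsetP=> u; rewrite inE => /andP[]. Qed.

Lemma card_partL k X U : #|partL k X U| + #|partL k X (~: U)| = #|X|.
Proof.
rewrite -[RHS](cardsID (kL k @^-1: U)); congr (_ + _); apply: eq_card => u; rewrite !inE //.
exact: andbC.
Qed.

Lemma card_partR k Y U : #|partR k Y U| + #|partR k Y (~: U)| = #|Y|.
Proof.
rewrite -[RHS](cardsID (kR k @^-1: U)); congr (_ + _); apply: eq_card => u; rewrite !inE //.
exact: andbC.
Qed.

Lemma card_partLU1 k X U t :
  #|partL k X (t |: U)| <= #|partL k X [set t]| + #|partL k X U|.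
Proof.
apply: leq_trans (leq_card_setU _ _); apply/subset_leq_card/subsetP=> u.
by rewrite !inE => /andP[-> /=].
Qed.

Lemma card_partRU1 k Y U t :
  #|partR k Y (t |: U)| <= #|partR k Y [set t]| + #|partR k Y U|.
Proof.
apply: leq_trans (leq_card_setU _ _); apply/subset_leq_card/subsetP=> u.
by rewrite !inE => /andP[-> /=].
Qed.

Lemma part_no_col k X Y U u v : 0 < k ->
  u \in partL k X U -> v \in partR k Y (~: U) -> col u v <> k.
Proof.
move=> k0; rewrite !inE => /andP[_ uU] /andP[_ /negP vU] E; apply: vU.
by rewrite -(col_class E).
Qed.

Lemma part_no_colC k X Y U u v : 0 < k ->
  u \in partL k X (~: U) -> v \in partR k Y U -> col u v <> k.
Proof. by move=> k0 uU vU; apply: (@part_no_col k X Y _ u v k0 uU); rewrite setCK. Qed.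

(** Components are added one by one until their union stops being small; without a hole, the last
    one then misses fewer than [s] vertices on each side. A small König cover inside it would
    contradict the absence of holes. *)
Lemma hole_or_matching k X Y s a : 0 < k ->
    a + s <= #|X| -> a + s <= #|Y| -> 3 * s <= #|X| -> 3 * s <= #|Y| ->
  hole k X Y s \/ class_matching k X Y a.
Proof.
move=> k0 aX aY sX sY; have [|noh] := hole_dec k X Y s; first by left.
have [s0|s0] := posnP s.
  left; exists set0, set0; split; rewrite ?sub0set ?s0 //.
  by move=> u v; rewrite inE.
right.
have cross X' Y' : X' \subset X -> Y' \subset Y ->
    (forall u v, u \in X' -> v \in Y' -> col u v <> k) -> (#|X'| < s) || (#|Y'| < s).
  move=> subX subY no; rewrite !ltnNge -negb_and; apply/negP => /andP[lX lY].
  by have [u [v [uX vY]]] := noh _ _ subX subY lX lY; apply: no.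
have crossU U := cross _ _ (partL_sub k X U) (partR_sub k Y (~: U))
  (fun u v => @part_no_col k X Y U u v k0).
have crossUC U := cross _ _ (partL_sub k X (~: U)) (partR_sub k Y U)
  (fun u v => @part_no_colC k X Y U u v k0).
pose small U := (#|partL k X U| < s) && (#|partR k Y U| < s).
have [||U [t [/andP[sL sR] nsU]]] := @exists_first_failure T small.
- rewrite /small; have [e1 e2] : partL k X set0 = set0 /\ partR k Y set0 = set0.
    by split; apply/setP=> u; rewrite !inE andbF.
  by rewrite e1 e2 !cards0 s0.
- rewrite /small; have -> : partL k X setT = X by apply/setP=> u; rewrite !inE andbT.
  by rewrite negb_and -!leqNgt; apply/orP; left; move: sX; clear; lia.
pose A := partL k X [set t]; pose B := partR k Y [set t].
have [lA lB] : #|X| < #|A| + 2 * s /\ #|Y| < #|B| + 2 * s.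
  have := card_partLU1 k X U t; have := card_partRU1 k Y U t.
  have := crossU (t |: U); have := crossUC (t |: U).
  have := card_partL k X (t |: U); have := card_partR k Y (t |: U).
  move: nsU sL sR sX sY s0; rewrite /small -/A -/B.
  move: #|partL k X U| #|partR k Y U| #|partL _ _ (~: _)| #|partR _ _ (~: _)| #|partL _ _ (_ |: _)|
    #|partR _ _ (_ |: _)| #|A| #|B|; move: #|X| #|Y|.
  clear; lia.
(* By now [B] has at least [s] vertices and meets no edge of colour [k] from outside the component,
   so fewer than [s] vertices of [X] are outside. *)
have {}lA : #|X| < #|A| + s.
  have := crossUC [set t]; have := card_partL k X [set t]; rewrite -/A -/B.
  move: #|partL _ _ _| lA lB sX sY; move: #|A| #|B| #|X| #|Y|; clear; lia.
have {}lB : #|Y| < #|B| + s.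
  have := crossU [set t]; have := card_partR k Y [set t]; rewrite -/A -/B.
  move: #|partR _ _ _| lA lB sX sY; move: #|A| #|B| #|X| #|Y|; clear; lia.
have [|cm|[A' [B' [sA' sB' lt no]]]] := @class_konig k A B t a.
- by move=> u v; rewrite inE => /andP[_ /set1P].
- by apply: class_matching_sub cm; [apply: partL_sub|apply: partR_sub].
have subA : A \subset X by apply: partL_sub.
have subB : B \subset Y by apply: partR_sub.
have lA' : #|A| <= #|A'| + #|A :\: A'|.
  by rewrite -(cardsID A' A) leq_add2r subset_leq_card ?subsetIr.
have lB' : #|B| <= #|B'| + #|B :\: B'|.
  by rewrite -(cardsID B' B) leq_add2r subset_leq_card ?subsetIr.
(* Vertices of [X] outside component [t] send no edge of colour [k] to [B'], so they may be joined
   to [A']. *)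
have c1 : (#|A' :|: X :\: A| < s) || (#|B'| < s).
  apply: cross; rewrite ?subUset ?subsetDl ?andbT.
  - exact: subset_trans subA.
  - exact: subset_trans subB.
  move=> u v /setUP[uA vB|/setDP[uX uA] vB]; first exact: no.
  apply: (@part_no_colC k X Y [set t]) => //; last by move/subsetP: sB' => ->.
  by move: uA; rewrite !inE uX.
have c2 : (#|A'| < s) || (#|B' :|: Y :\: B| < s).
  apply: cross; rewrite ?subUset ?subsetDl ?andbT.
  - exact: subset_trans subA.
  - exact: subset_trans subB.
  move=> u v uA /setUP[vB|/setDP[vY vB]]; first exact: no.
  apply: (@part_no_col k X Y [set t]) => //; first by move/subsetP: sA' => ->.
  by move: vB; rewrite !inE vY.
have dA : #|A' :|: X :\: A| = #|A'| + (#|X| - #|A|).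
  rewrite cardsU (_ : A' :&: _ = set0) ?cards0 ?subn0 ?cardsDS //.
  apply/setP=> u; rewrite !inE; move/subsetP: sA' => /(_ u).
  by rewrite !inE; case: (u \in A') => //= /(_ isT) ->.
have dB : #|B' :|: Y :\: B| = #|B'| + (#|Y| - #|B|).
  rewrite cardsU (_ : B' :&: _ = set0) ?cards0 ?subn0 ?cardsDS //.
  apply/setP=> u; rewrite !inE; move/subsetP: sB' => /(_ u).
  by rewrite !inE; case: (u \in B') => //= /(_ isT) ->.
have := subset_leq_card subA; have := subset_leq_card subB.
move: c1 c2 lt lA lB lA' lB' aX aY sX sY; rewrite dA dB; clear.
move: #|A :\: A'| #|B :\: B'| #|A'| #|B'| #|A| #|B| #|X| #|Y|; clear; lia.
Qed.

Definition almost_complete X Y gam :=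
  (forall u, u \in X -> #|[set v in Y | col u v == 0]| <= gam) /\
  (forall v, v \in Y -> #|[set u in X | col u v == 0]| <= gam).

Lemma almost_complete_sub X Y X' Y' gam : X' \subset X -> Y' \subset Y ->
  almost_complete X Y gam -> almost_complete X' Y' gam.
Proof.
move=> /subsetP sX /subsetP sY [HX HY]; split=> [u /sX/HX|v /sY/HY]; apply: leq_trans.
  by apply/subset_leq_card/subsetP=> v; rewrite !inE => /andP[/sY-> ->].
by apply/subset_leq_card/subsetP=> u; rewrite !inE => /andP[/sX-> ->].
Qed.

(** Two vertices of [A] miss at most [2 gam] vertices of [B] together, so they have a common
    neighbour. In the König alternative a remaining left vertex misses the whole remaining right
    side, which therefore has at most [gam] vertices. *)
Lemma one_color_class c (A : {set L}) (B : {set R}) gam :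
    0 < c -> 2 * gam < #|A| -> 2 * gam < #|B| ->
    almost_complete A B gam ->
    (forall u v, u \in A -> v \in B -> col u v = 0 \/ col u v = c) ->
  exists t, [/\ forall u, u \in A -> kL c u = t, forall v, v \in B -> kR c v = t &
    forall m, m + gam <= #|A| -> m + gam <= #|B| -> class_matching c A B m].
Proof.
move=> c0 gA gB [misA misB] colc.
have edge u v : u \in A -> v \in B -> v \notin [set v in B | col u v == 0] -> kL c u = kR c v.
  move=> uA vB; rewrite inE vB /= => nz; apply: col_class => //.
  by case: (colc u v uA vB) nz => [->|].
have [u0 u0A] : exists u0, u0 \in A by apply/card_gt0P; apply: leq_ltn_trans gA.
have clA u : u \in A -> kL c u = kL c u0.
  move=> uA; have : 0 < #|B :\: ([set v in B | col u v == 0] :|: [set v in B | col u0 v == 0])|.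
    rewrite cardsD subn_gt0; apply: leq_ltn_trans (subset_leq_card (subsetIr _ _)) _.
    apply: leq_ltn_trans (leq_card_setU _ _) _; apply: leq_ltn_trans gB.
    by rewrite mul2n -addnn leq_add ?misA.
  case/card_gt0P=> v /setDP[vB]; rewrite in_setU negb_or => /andP[n1 n2].
  by rewrite (edge u v) // (edge u0 v).
exists (kL c u0); split => // [v vB|m mA mB].
  have : 0 < #|A :\: [set u in A | col u v == 0]|.
    rewrite cardsD subn_gt0; apply: leq_ltn_trans (subset_leq_card (subsetIr _ _)) _.
    by apply: leq_ltn_trans (misB _ vB) _; apply: leq_ltn_trans gA; rewrite leq_pmull.
  case/card_gt0P=> u /setDP[uA nu].
  rewrite -(edge u v) ?clA // inE vB; by move: nu; rewrite inE uA.
have [|//|[A' [B' [sA' sB' lt no]]]] := @class_konig c A B (kL c u0) m.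
  by move=> u v uA _ _; apply: clA.
have lA' : #|A| <= #|A'| + #|A :\: A'|.
  by rewrite -(cardsID A' A) leq_add2r subset_leq_card ?subsetIr.
have lB' : #|B| <= #|B'| + #|B :\: B'|.
  by rewrite -(cardsID B' B) leq_add2r subset_leq_card ?subsetIr.
have [u uA'] : exists u, u \in A'.
  apply/card_gt0P; move: lA' mA lt; clear; lia.
have uA : u \in A by move/subsetP: sA' => ->.
have : #|B'| <= gam.
  apply: leq_trans (misA _ uA); apply/subset_leq_card/subsetP=> v vB'.
  have vB : v \in B by move/subsetP: sB' => ->.
  rewrite inE vB; by case: (colc u v uA vB) => [->//|/(no _ _ uA' vB')].
by move: lB' mB lt; clear; lia.
Qed.

(** If no large matching exists in colour [c], deleting fewer than [a] vertices leaves only colour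
    [c'] and missing edges. *)
Lemma near_class c c' X Y t a a' gam : 0 < c -> 0 < c' ->
    (forall u v, u \in X -> v \in Y -> [\/ col u v = 0, col u v = c | col u v = c']) ->
    almost_complete X Y gam ->
    (forall u v, u \in X -> v \in Y -> col u v = c -> kL c u = t) ->
    a + a' + 2 * gam < #|X| -> a + a' + 2 * gam < #|Y| ->
  class_matching c X Y a \/ class_matching c' X Y a'.
Proof.
move=> c0 c'0 colc ac clt aX aY.
have [|[X' [Y' [sX' sY' lt no]]]] := class_konig a clt; [by left|right].
have lX' : #|X| <= #|X'| + #|X :\: X'|.
  by rewrite -(cardsID X' X) leq_add2r subset_leq_card ?subsetIr.
have lY' : #|Y| <= #|Y'| + #|Y :\: Y'|.
  by rewrite -(cardsID Y' Y) leq_add2r subset_leq_card ?subsetIr.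
have [||||t' [_ _ H]] := @one_color_class c' X' Y' gam c'0.
- by move: lX' aX lt; clear; lia.
- by move: lY' aY lt; clear; lia.
- exact: almost_complete_sub ac.
- move=> u v uX' vY'.
  have [|/(no _ _ uX' vY')|] := colc u v (subsetP sX' _ uX') (subsetP sY' _ vY') => //;
    by [left|right].
apply: class_matching_sub sX' sY' _; apply: H.
  by move: lX' aX lt; clear; lia.
by move: lY' aY lt; clear; lia.
Qed.


Lemma two_colors X Y a b gam :
    (forall u v, u \in X -> v \in Y -> col u v <= 2) ->
    almost_complete X Y gam ->
    a + b + 8 * gam < #|X| -> a + b + 8 * gam < #|Y| ->
  class_matching 1 X Y a \/ class_matching 2 X Y b.
Proof.
move=> col2 ac abX abY.
have col012 u v : u \in X -> v \in Y -> [\/ col u v = 0, col u v = 1 | col u v = 2].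
  by move=> uX vY; move: (col2 u v uX vY); case: (col u v) => [|[|[|]]] //; constructor.
have col021 u v : u \in X -> v \in Y -> [\/ col u v = 0, col u v = 2 | col u v = 1].
  by move=> uX vY; case: (col012 u v uX vY); constructor.
pose A U := partL 1 X U; pose B U := partR 1 Y U.
have sA U : A U \subset X by apply: partL_sub.
have sB U : B U \subset Y by apply: partR_sub.
have color2 U : 2 * gam < #|A U| -> 2 * gam < #|B (~: U)| ->
    exists t, [/\ forall u, u \in A U -> kL 2 u = t, forall v, v \in B (~: U) -> kR 2 v = t &
    forall m, m + gam <= #|A U| -> m + gam <= #|B (~: U)| ->
      class_matching 2 (A U) (B (~: U)) m].
  move=> lA lB; apply: one_color_class lA lB _ _ => //; first exact: almost_complete_sub ac.
  move=> u v uA vB; have no : col u v <> 1 by apply: (@part_no_col 1 X Y U).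
  by case: (col012 u v (subsetP (sA _) _ uA) (subsetP (sB _) _ vB)) => // ->; [left|right].
have cA U : #|A U| + #|A (~: U)| = #|X| by apply: card_partL.
have cB U : #|B U| + #|B (~: U)| = #|Y| by apply: card_partR.
have big2 X' Y' t : X' \subset X -> Y' \subset Y ->
    (forall u v, u \in X' -> v \in Y' -> col u v = 2 -> kL 2 u = t) ->
    a + b + 2 * gam < #|X'| -> a + b + 2 * gam < #|Y'| ->
    class_matching 1 X Y a \/ class_matching 2 X Y b.
  move=> sX' sY' Ht lX lY; rewrite (addnC a) in lX lY.
  have [//|//|||//|||cm|cm] := @near_class 2 1 X' Y' t b a gam.
  - by move=> u v /(subsetP sX') uX /(subsetP sY') vY; apply: col021.
  - exact: almost_complete_sub ac.
  - by move: lX; clear; lia.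
  - by move: lY; clear; lia.
  - by right; apply: class_matching_sub cm.
  - by left; apply: class_matching_sub cm.
(* First case: the components of colour 1 fall into two groups with all four parts large. The
   off-diagonal blocks then carry only colour 2, each within one class. *)
have [/existsP[U /and4P[A1 A2 B1 B2]]|/existsPn nosplit] :=
    boolP [exists U : {set T}, [&& 2 * gam < #|A U|, 2 * gam < #|A (~: U)|,
      2 * gam < #|B U| & 2 * gam < #|B (~: U)|]].
  have [t [tA tB mt]] := color2 U A1 B2.
  have [|t' [tA' tB' mt']] := color2 (~: U) A2; first by rewrite setCK.
  rewrite setCK in tB' mt'.
  have [tt'|ntt'] := eqVneq t t'.
    apply: (big2 X Y t) => //.
    - move=> u v uX vY _; have [uU|uU] := boolP (kL 1 u \in U).
        by apply: tA; rewrite inE uX.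
      by rewrite tt'; apply: tA'; rewrite !inE uX.
    - by move: abX; clear; lia.
    - by move: abY; clear; lia.
  (* An edge of colour 2 in a diagonal block would join the two distinct classes, so these blocks
     carry only colour 1. *)
  have color1 V s s' : 2 * gam < #|A V| -> 2 * gam < #|B V| -> s != s' ->
      (forall u, u \in A V -> kL 2 u = s) -> (forall v, v \in B V -> kR 2 v = s') ->
      forall m, m + gam <= #|A V| -> m + gam <= #|B V| -> class_matching 1 X Y m.
    move=> lA lB ss' HA HB m mA mB.
    have [//||||u v uA vB|_ [_ _ H]] := @one_color_class 1 (A V) (B V) gam.
    - exact: lA.
    - exact: lB.
    - exact: almost_complete_sub ac.
    - case: (col012 u v (subsetP (sA _) _ uA) (subsetP (sB _) _ vB)); try by [left|right].
      by move/(@col_class 2)/(_ isT); rewrite HA // HB // => /eqP; rewrite (negPf ss').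
    - by apply: class_matching_sub (H m mA mB).
  have m11 := color1 U _ _ A1 B1 ntt' tA tB'.
  have ntt := ntt'; rewrite eq_sym in ntt.
  have m22 := color1 (~: U) _ _ A2 B2 ntt tA' tB.
  have := cA U; have := cB U.
  have [/andP[? ?]|n1] := boolP ((a + gam <= #|A U|) && (a + gam <= #|B U|)).
    by left; apply: m11.
  have [/andP[? ?]|n2] := boolP ((a + gam <= #|A (~: U)|) && (a + gam <= #|B (~: U)|)).
    by left; apply: m22.
  have [/andP[? ?]|n3] := boolP ((b + gam <= #|A U|) && (b + gam <= #|B (~: U)|)).
    by right; apply: class_matching_sub (mt b _ _).
  have [/andP[? ?]|n4] := boolP ((b + gam <= #|A (~: U)|) && (b + gam <= #|B U|)).
    by right; apply: class_matching_sub (mt' b _ _).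
  (* If each block has a side too short for its matching, [|X|] or [|Y|] is below
     [a + b + 2 gam]. *)
  move: n1 n2 n3 n4 abX abY.
  by move: #|A U| #|A (~: U)| #|B U| #|B (~: U)| #|X| #|Y|; clear; lia.
pose small U := (#|A U| <= 2 * gam) && (#|B U| <= 2 * gam).
(* If exactly one side of the group is small, its large side and the complement of the small one
   form a block of colour 2 in one class. That complement is almost a whole side, so [big2]
   concludes. *)
have half U : (#|A U| <= 2 * gam) || (#|B U| <= 2 * gam) -> small U \/
    (class_matching 1 X Y a \/ class_matching 2 X Y b).
  have [sm|nsm] := boolP (small U); first by left.
  move=> one; right; have cAU := cA U; have cBU := cB U.
  have [sAU|lAU] := leqP #|A U| (2 * gam).
    have lB : 2 * gam < #|B U| by move: nsm; rewrite /small sAU -ltnNge.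
    have [||t [tA _ _]] := color2 (~: U).
    - by move: sAU cAU abX; move: #|A U| #|A (~: U)| #|X|; clear; lia.
    - by rewrite setCK.
    apply: (big2 (A (~: U)) Y t) => //.
    - by move=> u v uA _ _; apply: tA.
    - by move: sAU cAU abX; move: #|A U| #|A (~: U)| #|X|; clear; lia.
    - by move: abY; clear; lia.
  have sBU : #|B U| <= 2 * gam by move: one; rewrite leqNgt lAU.
  have [||t [_ tB _]] := color2 U => //.
    by move: sBU cBU abY; move: #|B U| #|B (~: U)| #|Y|; clear; lia.
  apply: (big2 X (B (~: U)) t) => //.
  - by move=> u v uA vB /(@col_class 2)/(_ isT) ->; apply: tB.
  - by move: abX; clear; lia.
  - by move: sBU cBU abY; move: #|B U| #|B (~: U)| #|Y|; clear; lia.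
have [||U [t [/andP[sAU sBU] nsU]]] := @exists_first_failure T small.
- rewrite /small; have [e1 e2] : A set0 = set0 /\ B set0 = set0.
    by split; apply/setP=> u; rewrite !inE andbF.
  by rewrite e1 e2 !cards0.
- rewrite /small; have -> : A setT = X by apply/setP=> u; rewrite !inE andbT.
  by rewrite negb_and -!ltnNge; apply/orP; left; move: abX; clear; lia.
pose V := t |: U.
have [halfV|nhalfV] := boolP ((#|A V| <= 2 * gam) || (#|B V| <= 2 * gam)).
  by have [sm|//] := half V halfV; rewrite sm in nsU.
have [|/andP[sAV _]|//] := half (~: V).
  move: nhalfV (nosplit V); rewrite negb_or -!ltnNge => /andP[-> ->] /=.
  by rewrite negb_and -!leqNgt.
pose W := A [set t].
(* [U] and the complement of [V] each take at most [2 gam] vertices of [X]; the rest belongs to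
   component [t]. *)
have lW : #|X| <= #|W| + 4 * gam.
  have := card_partLU1 1 X U t; have := cA V; rewrite -/(A _) -/(A _) -/W -/V.
  move: sAU sAV; move: #|A (~: V)| #|A V| #|A U| #|W| #|X|; clear; lia.
have [//|//||||||cm|cm] := @near_class 1 2 W Y t a b gam.
- by move=> u v /(subsetP (sA _)) uX vY; apply: col012.
- exact: almost_complete_sub (sA _) (subxx Y) ac.
- by move=> u v; rewrite inE => /andP[_ /set1P].
- by move: lW abX; clear; lia.
- by move: abY; clear; lia.
- by left; apply: class_matching_sub (sA _) (subxx Y) cm.
- by right; apply: class_matching_sub (sA _) (subxx Y) cm.
Qed.

(** With [s] the size needed by the earlier colours, [growth] makes the last [m k] at least [2 s],
    so both sides have the [3 s] vertices that [hole_or_matching] asks for. The slack [sigma] pays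
    for the two-colour case. *)
Lemma ramsey_matching (m : nat -> nat) sigma gam r X Y :
    8 * gam < sigma -> 2 <= r ->
    (forall k, 3 <= k <= r -> 2 * (\sum_(1 <= i < k) m i + sigma) <= m k) ->
    \sum_(1 <= i < r.+1) m i + sigma <= #|X| ->
    \sum_(1 <= i < r.+1) m i + sigma <= #|Y| ->
    (forall u v, u \in X -> v \in Y -> col u v <= r) ->
    almost_complete X Y gam ->
  exists i, 1 <= i <= r /\ class_matching i X Y (m i).
Proof.
move=> gs; elim: r X Y => // r IH X Y; rewrite leq_eqVlt => /predU1P[<- _|r2 growth].
  rewrite big_nat_recr //= big_nat1 => lX lY col2 ac.
  have [||cm|cm] := two_colors (a := m 1) (b := m 2) col2 ac.
  - by move: lX gs; clear; lia.
  - by move: lY gs; clear; lia.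
  - by exists 1.
  - by exists 2.
rewrite big_nat_recr //= => lX lY colr ac.
have gr := growth r.+1; rewrite r2 leqnn in gr; move/(_ isT): gr => gr.
set s := \sum_(1 <= i < r.+1) m i + sigma in gr.
have [//|||||[X' [Y' [sX sY lX' lY' no]]]|cm] := @hole_or_matching r.+1 X Y s (m r.+1).
- by move: lX; rewrite /s; clear; lia.
- by move: lY; rewrite /s; clear; lia.
- by move: lX gr; rewrite /s; clear; lia.
- by move: lY gr; rewrite /s; clear; lia.
- have [|u v uX vY||i [/andP[i1 ir] cm]] := IH X' Y' r2 _ lX' lY'.
  + by move=> k /andP[k3 kr]; apply: growth; rewrite k3 ltnW.
  + have := colr u v (subsetP sX _ uX) (subsetP sY _ vY).
    by rewrite leq_eqVlt => /predU1P[/(no _ _ uX vY)|].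
  + exact: almost_complete_sub ac.
  + by exists i; rewrite i1 leqW //; split => //; apply: class_matching_sub cm.
- by exists r.+1; rewrite leqnn.
Qed.

End Ramsey.

(** * Closed walks in the cluster graph *)

Section ClosedWalk.
Variables (T : finType) (e : rel T).
Hypothesis sym_e : symmetric e.

Lemma insert_edge w x y : cycle e w -> x \in w -> e x y ->
  exists2 w', cycle e w' & perm_eq w' (x :: y :: w).
Proof.
move=> cw xw exy; have [i s rw] := rot_to xw.
exists [:: x, y, x & s]; last by rewrite !perm_cons -rw perm_rot.
by move: cw; rewrite -(rot_cycle i) rw /= exy sym_e exy.
Qed.

Lemma insert_edges w (l : seq (T * T)) : cycle e w ->
    {in l, forall p, p.1 \in w /\ e p.1 p.2} ->
  exists2 w', cycle e w' & perm_eq w' (flatten [seq [:: p.1; p.2] | p <- l] ++ w).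
Proof.
move=> cw; elim: l => [|p l IH] lw; first by exists w.
have [|w1 cw1 pw1] := IH; first by move=> q ql; apply: lw; rewrite inE ql orbT.
have [p1 ep] := lw p (mem_head _ _).
have [|w2 cw2 pw2] := insert_edge cw1 _ ep.
  by rewrite (perm_mem pw1) mem_cat p1 orbT.
by exists w2 => //; apply: perm_trans pw2 _; rewrite /= !perm_cons.
Qed.

(** Each back-and-forth detour reaches a new vertex, so [h] never exceeds the number of visited
    vertices. *)
Lemma spanning_closed_walk x y : e x y -> exists w h,
  [/\ cycle e w, size w = 2 * h, h <= #|T| & forall z, connect e x z -> z \in w].
Proof.
move=> exy.
suff H n w h : #|T| - #|[set z in w]| <= n -> cycle e w -> x \in w ->
    size w = 2 * h -> h <= #|[set z in w]| ->
    exists w h, [/\ cycle e w, size w = 2 * h, h <= #|T| & forall z, connect e x z -> z \in w].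
  apply: (H #|T| [:: x; y] 1); rewrite ?leq_subr ?inE ?eqxx //=.
    by rewrite exy sym_e exy.
  by apply/card_gt0P; exists x; rewrite !inE eqxx.
elim: n w h => [|n IH] w h len cw xw sw hw.
  exists w, h; split => //; first exact: leq_trans hw (max_card _).
  have wT : [set z in w] = setT.
    apply/eqP; rewrite eqEcard subsetT cardsT; move: len; rewrite leqn0 subn_eq0//.
  by move=> z _; have := in_setT z; rewrite -wT inE.
have [clo|/forallPn[a]] := boolP [forall a, forall b, (a \in w) ==> e a b ==> (b \in w)].
  exists w, h; split => //; first exact: leq_trans hw (max_card _).
  have stay p a : a \in w -> path e a p -> last a p \in w.
    elim: p a => [//|b p IHp] a aw /= /andP[eab pb]; apply: IHp pb.
    by move/forallP/(_ a)/forallP/(_ b): clo; rewrite aw eab.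
  by move=> z /connectP[p px ->]; apply: stay.
case/forallPn=> b; rewrite !negb_imply => /and3P[aw eab bw].
have [w' cw' pw'] := insert_edge cw aw eab.
have cE : #|[set z in w']| = #|[set z in w]|.+1.
  have -> : [set z in w'] = b |: [set z in w].
    apply/setP=> z; rewrite !inE (perm_mem pw') !inE; case: eqP => // ->.
    by rewrite aw orbT.
  by rewrite cardsU1 inE bw.
apply: (IH w' h.+1); rewrite ?cE //.
- by move: len; clear; lia.
- by rewrite (perm_mem pw') !inE xw !orbT.
- by rewrite (perm_size pw') /= sw; clear; lia.
Qed.

End ClosedWalk.

(** * The graph of one colour and its clusters *)

Section ColorGraph.
Variables (L R : finType) (col : L -> R -> nat) (k : nat).

Definition color_rel : rel (L + R) := fun x y =>
  match x, y with
  | inl u, inr v | inr v, inl u => col u v == k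
  | _, _ => false
  end.

Lemma color_rel_sym : symmetric color_rel. Proof. by case=> ? []. Qed.
Lemma color_rel_irr : irreflexive color_rel. Proof. by case. Qed.

Variables (I J : finType) (P : L -> I) (Q : R -> J) (D K : nat).

Definition label (x : L + R) : I + J :=
  match x with inl u => inl (P u) | inr v => inr (Q v) end.

Lemma subset_cluster_inl i (A : {set L + R}) : A \subset cluster label (inl i) ->
  exists2 A' : {set L}, A = inl @: A' & A' \subset P @^-1: [set i].
Proof.
move=> /subsetP sA; exists (inl @^-1: A); apply/setP || apply/subsetP.
  case=> [u|v]; first by rewrite mem_imset ?inE //; apply: inl_inj.
  apply/idP/imsetP => [/sA|[]//]; by rewrite !inE.
by move=> u; rewrite !inE => /sA; rewrite !inE.
Qed.

Lemma subset_cluster_inr j (A : {set L + R}) : A \subset cluster label (inr j) ->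
  exists2 A' : {set R}, A = inr @: A' & A' \subset Q @^-1: [set j].
Proof.
move=> /subsetP sA; exists (inr @^-1: A); apply/setP || apply/subsetP.
  case=> [u|v]; last by rewrite mem_imset ?inE //; apply: inr_inj.
  apply/idP/imsetP => [/sA|[]//]; by rewrite !inE.
by move=> u; rewrite !inE => /sA; rewrite !inE.
Qed.

Lemma card_cluster_inl i : #|cluster label (inl i)| = #|P @^-1: [set i]|.
Proof.
rewrite -(card_imset _ (@inl_inj L R)); apply: eq_card => -[u|v].
  by rewrite mem_imset ?inE //; apply: inl_inj.
by rewrite !inE; apply/esym/negP => /imsetP[].
Qed.

Lemma card_cluster_inr j : #|cluster label (inr j)| = #|Q @^-1: [set j]|.
Proof.
rewrite -(card_imset _ (@inr_inj L R)); apply: eq_card => -[u|v].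
  by rewrite !inE; apply/esym/negP => /imsetP[].
by rewrite mem_imset ?inE //; apply: inr_inj.
Qed.

(** Averaging the edge count over either side yields a vertex of large degree. *)
Lemma lreg_lower_dense i j : lreg col D K k (P @^-1: [set i]) (Q @^-1: [set j]) ->
  lower_dense label color_rel D K (inl i) (inr j) /\
  lower_dense label color_rel D K (inr j) (inl i).
Proof.
move=> reg.
have {}reg (A : {set L}) (B : {set R}) : A \subset P @^-1: [set i] -> B \subset Q @^-1: [set j] ->
    #|P @^-1: [set i]| <= K * #|A| -> #|Q @^-1: [set j]| <= K * #|B| ->
    #|A| * #|B| < 2 * D * ecount col k A B.
  move=> sA sB lA lB; move/forallP/(_ A)/forallP/(_ B)/implyP: reg; apply.
  by rewrite sA sB lA lB.
have sum_card (U : finType) (S : {set U}) (a : pred U) :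
    #|[set x in S | a x]| = \sum_(x in S) a x.
  rewrite -sum1_card (eq_bigl (fun x => (x \in S) && a x)) => [|x]; last by rewrite inE.
  by rewrite big_mkcondr; apply: eq_bigr => x _; case: (a x).
have avg (U : finType) (S : {set U}) (f : U -> nat) b :
    #|S| * b < \sum_(a in S) f a -> exists2 a, a \in S & b < f a.
  move=> lt; apply/exists_inP; apply: contraLR lt => /exists_inPn H.
  by rewrite -leqNgt -sum_nat_const; apply: leq_sum => a /H; rewrite -leqNgt.
have degl u (B : {set R}) : #|nbhd color_rel (inl u) (inr @: B)| = \sum_(v in B) (col u v == k).
  rewrite (_ : nbhd _ _ _ = inr @: [set v in B | col u v == k]).
    by rewrite card_imset ?sum_card; last exact: inr_inj.
  apply/setP=> -[u'|v]; rewrite inE.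
    by rewrite andbF; apply/esym/negP => /imsetP[].
  by rewrite !(mem_imset _ _ (@inr_inj L R)) inE.
have degr v (A : {set L}) : #|nbhd color_rel (inr v) (inl @: A)| = \sum_(u in A) (col u v == k).
  rewrite (_ : nbhd _ _ _ = inl @: [set u in A | col u v == k]).
    by rewrite card_imset ?sum_card; last exact: inl_inj.
  apply/setP=> -[u|v']; rewrite inE.
    by rewrite !(mem_imset _ _ (@inl_inj L R)) inE.
  by rewrite andbF; apply/esym/negP => /imsetP[].
split=> A B.
  case/subset_cluster_inl => A' -> sA /subset_cluster_inr[B' -> sB].
  rewrite card_cluster_inl card_cluster_inr !card_imset; try exact: inl_inj; try exact: inr_inj.
  move=> lA lB; have := reg A' B' sA sB lA lB; rewrite /ecount big_distrr /=.
  case/avg=> u uA lt; exists (inl u); first by rewrite mem_imset //; apply: inl_inj.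
  by rewrite degl.
case/subset_cluster_inr => B' -> sB /subset_cluster_inl[A' -> sA].
rewrite card_cluster_inl card_cluster_inr !card_imset; try exact: inl_inj; try exact: inr_inj.
move=> lB lA; have := reg A' B' sA sB lA lB; rewrite /ecount exchange_big big_distrr /= mulnC.
case/avg=> v vB lt; exists (inr v); first by rewrite mem_imset //; apply: inr_inj.
by rewrite degr.
Qed.
End ColorGraph.

Lemma count_flatten_pairs (I J : finType) (l : seq (I * J)) (t : I + J) :
  count_mem t (flatten [seq [:: inl p.1; inr p.2] | p <- l]) =
  match t with inl i => count (fun p => p.1 == i) l | inr j => count (fun p => p.2 == j) l end.
Proof.
elim: l => [|p l IH]; first by case: t.
by case: t IH => t /= ->; rewrite !eqE /=.
Qed.

(** A spanning walk of the component is the skeleton, and matching edges are inserted as detours.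
    Only the skeleton visits a cluster beyond its matched vertices. *)
Lemma matching_walk (L R I J : finType) (P : L -> I) (Q : R -> J) (e : rel (I + J))
    (M : {set L * R}) t :
    symmetric e -> matching M -> #|I| + #|J| <= #|M| -> 0 < #|M| ->
    (forall p, p \in M -> e (inl (P p.1)) (inr (Q p.2)) /\ fingraph.root e (inl (P p.1)) = t) ->
  exists w, [/\ cycle e w, size w = 2 * #|M|,
    forall i, inl i \in w -> count_mem (inl i) w <=
      2 * (#|I| + #|J|) + #|[set u in fst @: M | P u == i]| &
    forall j, inr j \in w -> count_mem (inr j) w <=
      2 * (#|I| + #|J|) + #|[set v in snd @: M | Q v == j]|].
Proof.
move=> sym_e [i1 i2] bigM /card_gt0P[p0 p0M] HM.
have [e0 r0] := HM p0 p0M.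
have [w0 [h [cw0 sw0 hT conn_w0]]] := spanning_closed_walk sym_e e0.
rewrite card_sum in hT; have hM := leq_trans hT bigM.
(* With [|M| - h] detours the total length is exactly [2 |M|]. *)
have [M' sM' cM'] := exists_subset_card (leq_subr h #|M|).
pose l := [seq (inl (P p.1), inr (Q p.2)) : (I + J) * (I + J) | p <- enum M'].
have [|w cw pw] := @insert_edges _ e sym_e w0 l cw0.
  move=> q /mapP[p /[!mem_enum] pM' ->] /=; have pM := subsetP sM' _ pM'.
  have [ep rp] := HM p pM; split => //; apply: conn_w0.
  by apply/(fingraph.rootP (sym_connect_sym sym_e)); rewrite r0 rp.
have flat : [seq [:: p.1; p.2] | p <- l] =
    [seq [:: inl p.1; inr p.2] | p <- [seq (P p.1, Q p.2) | p <- enum M']].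
  by rewrite -!map_comp; apply: eq_map.
rewrite flat in pw.
have szf (l' : seq (I * J)) : size (flatten [seq [:: inl p.1; inr p.2 : I + J] | p <- l']) = 2 * size l'.
  by elim: l' => //= a l' ->; rewrite mulnS.
exists w; split => //.
- rewrite (perm_size pw) size_cat szf size_map -cardE cM' sw0.
  by rewrite -mulnDr subnK.
- move=> i _; move/permP: pw => ->; rewrite count_cat count_flatten_pairs addnC leq_add //.
    by apply: leq_trans (count_size _ _) _; rewrite sw0 leq_mul2l hT.
  rewrite count_map -size_filter.
  apply: leq_trans (_ : #|[set p in M' | P p.1 == i]| <= _).
    rewrite cardE; apply: uniq_leq_size; first by rewrite filter_uniq ?enum_uniq.
    by move=> p; rewrite mem_filter !mem_enum !inE /= andbC.
  have inj : {in [set p in M' | P p.1 == i] &, injective fst}.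
    move=> p q; rewrite !inE => /andP[/(subsetP sM') pM _] /andP[/(subsetP sM') qM _].
    by apply: i1.
  rewrite -(card_in_imset inj).
  apply/subset_leq_card/subsetP=> _ /imsetP[p /[!inE]/andP[/(subsetP sM') pM pi] ->].
  by rewrite imset_f.
- move=> j _; move/permP: pw => ->; rewrite count_cat count_flatten_pairs addnC leq_add //.
    by apply: leq_trans (count_size _ _) _; rewrite sw0 leq_mul2l hT.
  rewrite count_map -size_filter.
  apply: leq_trans (_ : #|[set p in M' | Q p.2 == j]| <= _).
    rewrite cardE; apply: uniq_leq_size; first by rewrite filter_uniq ?enum_uniq.
    by move=> p; rewrite mem_filter !mem_enum !inE /= andbC.
  have inj : {in [set p in M' | Q p.2 == j] &, injective snd}.
    move=> p q; rewrite !inE => /andP[/(subsetP sM') pM _] /andP[/(subsetP sM') qM _].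
    by apply: i2.
  rewrite -(card_in_imset inj).
  apply/subset_leq_card/subsetP=> _ /imsetP[p /[!inE]/andP[/(subsetP sM') pM pj] ->].
  by rewrite imset_f.
Qed.

(** * Reserved vertices and counts of missing edges *)

Lemma exists_reserve (V I : finType) (P : V -> I) q : 1 < q ->
  exists X : {set V},
    (forall i, 2 * #|P @^-1: [set i]| <= q * #|P @^-1: [set i] :\: X|) /\
    q * #|~: X| <= 2 * #|V| + q * #|I|.
Proof.
(* A share [2/q] of each cell is reserved, rounded up and capped by the cell. The rounding costs one
   vertex per cell, whence the term [q * #|I|]. *)
move=> q1; pose z i := minn #|P @^-1: [set i]| (2 * #|P @^-1: [set i]| %/ q).+1.
have [Z HZ] : exists Z : I -> {set V}, forall i, Z i \subset P @^-1: [set i] /\ #|Z i| = z i.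
  apply: (@fin_all_exists _ (fun=> {set V}) (fun i Z => Z \subset P @^-1: [set i] /\ #|Z| = z i)) => i.
  have [Z ? ?] := @exists_subset_card _ (P @^-1: [set i]) (z i) (geq_minl _ _); by exists Z.
have inZ u i : u \in Z i -> P u = i.
  by case: (HZ i) => /subsetP sZ _ /sZ; rewrite !inE => /eqP.
have DX i : P @^-1: [set i] :\: [set u | u \notin Z (P u)] = Z i.
  apply/setP=> u; rewrite !inE negbK; apply/andP/idP => [[+ /eqP<-]//|uZ].
  by rewrite (inZ _ _ uZ) uZ eqxx.
exists [set u | u \notin Z (P u)]; split=> [i|].
  rewrite DX; case: (HZ i) => _ ->; rewrite /z; set c := #|_|.
  have [le|lt] := leqP c (2 * c %/ q).+1; first by rewrite leq_mul2r q1 orbT.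
  by rewrite [q * _]mulnC ltnW // ltn_ceil // ltnW.
have -> : ~: [set u | u \notin Z (P u)] = [set u | u \in Z (P u)].
  by apply/setP=> u; rewrite !inE negbK.
rewrite (card_cells P) -sum1_card (partition_big P predT) //= !big_distrr /=.
rewrite mulnC -sum_nat_const -big_split /=; apply: leq_sum => i _.
rewrite (eq_bigl (fun u => u \in Z i)) => [|u]; last first.
  by rewrite inE; apply/andP/idP => [[+ /eqP<-]//|uZ]; rewrite (inZ _ _ uZ) uZ.
rewrite sum1_card; case: (HZ i) => _ ->.
apply: leq_trans (_ : q * (2 * #|P @^-1: [set i]| %/ q).+1 <= _).
  by rewrite leq_mul2l geq_minr orbT.
by rewrite mulnS addnC leq_add2r mulnC leq_trunc_div.
Qed.

(** Markov's inequality for the row sums of [f]. *)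
Lemma few_bad_vertices (L R : finType) (f : L -> R -> bool) gam :
  #|[set u | gam < #|[set v | f u v]|]| * gam.+1 <= \sum_u \sum_v f u v.
Proof.
rewrite -sum_nat_const [X in _ <= X](bigID (fun u => gam < #|[set v | f u v]|)) /=.
apply: leq_trans (leq_addr _ _).
rewrite (eq_bigl (fun u => gam < #|[set v | f u v]|)) => [|u]; last by rewrite inE.
apply: leq_sum => u; rewrite -sum1_card (eq_bigl (f u)) => [|v]; last by rewrite inE.
rewrite big_mkcond /= => lt; apply: leq_trans lt _; apply: leq_sum => v _.
by case: (f u v).
Qed.

Lemma small_cells (V I : finType) (P : V -> I) tau :
  \sum_u (#|P @^-1: [set P u]| < tau) <= #|I| * tau.
Proof.
rewrite (partition_big P predT) //= -sum_nat_const; apply: leq_sum => i _.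
rewrite (eq_bigr (fun=> (#|P @^-1: [set i]| < tau) : nat)) => [|u /eqP-> //].
rewrite (eq_bigl (fun u => u \in P @^-1: [set i])) => [|u]; last by rewrite !inE.
by rewrite sum_nat_const; case: ltnP => [/ltnW|]; rewrite ?muln1 ?muln0.
Qed.

Lemma sum_cells (L R I J : finType) (P : L -> I) (Q : R -> J) (f : I -> J -> bool) :
  \sum_u \sum_v f (P u) (Q v) =
  \sum_i \sum_(j | f i j) #|P @^-1: [set i]| * #|Q @^-1: [set j]|.
Proof.
rewrite (partition_big P predT) //=; apply: eq_bigr => i _.
rewrite (eq_bigr (fun=> \sum_v f i (Q v))) => [|u /eqP-> //].
rewrite (eq_bigl (fun u => u \in P @^-1: [set i])) => [|u]; last by rewrite !inE.
rewrite sum_nat_const (partition_big Q predT) //= [RHS]big_mkcond big_distrr.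
apply: eq_bigr => j _ /=; rewrite (eq_bigr (fun=> f i j : nat)) => [|v /eqP-> //].
rewrite (eq_bigl (fun v => v \in Q @^-1: [set j])) => [|v]; last by rewrite !inE.
by rewrite sum_nat_const; case: (f i j); rewrite ?muln1 ?muln0.
Qed.

(** Here [b] vertices miss more than [g] edges each, where [g] is about [n / (64 d)], out of at most
    [2 n^2 / (1024 d^2)] missing edges. *)
Fact few_bad_count b g n d s : b * g.+1 * (1024 * d ^ 2) <= 2 * n ^ 2 ->
  n < g.+1 * (64 * d) -> n <= d * s -> 0 < n -> 0 < d -> 8 * b <= s.
Proof.
move=> h1 h2 h3 n0 d0.
have : (b * (1024 * d ^ 2)) * n <= (2 * n * (64 * d)) * n.
  apply: leq_trans (_ : b * (1024 * d ^ 2) * (g.+1 * (64 * d)) <= _).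
    by rewrite leq_mul2l ltnW ?orbT.
  have := leq_mul h1 (leqnn (64 * d)); clear; nia.
rewrite leq_pmul2r // => h4.
have : (8 * b) * (128 * d ^ 2) <= s * (128 * d ^ 2) by move: h4 h3; clear; nia.
by rewrite leq_pmul2r // muln_gt0 expn_gt0 d0.
Qed.

(** [a1] and [a2] count the vertices in small clusters of the two sides, and [b] is the weight of
    the bad pairs. *)
Fact missing_count e n b a1 a2 x : e * b <= n * n -> a1 <= x -> a2 <= x ->
  2 * e * x <= n -> e * (n * a1 + (n * a2 + b)) <= 2 * n ^ 2.
Proof.
move=> h1 h2 h3 h4; apply: leq_trans (_ : n * (2 * e * x) + n * n <= _).
  rewrite !mulnDr addnA leq_add //.
  by have := leq_mul (leqnn (e * n)) (leq_add h2 h3); clear; nia.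
by have := leq_mul (leqnn n) h4; clear; lia.
Qed.

(** * Monochromatic cycles under integer size conditions *)

Section MonochromaticCycle.
Variables (r Dn : nat).
Hypotheses (r2 : 2 <= r) (Dn0 : 0 < Dn).
(* D counts the colours 0, ..., r.  A share 2/Q of every cluster is kept out of the
   matching, K is the regularity scale and 1/E bounds the weight of bad pairs. *)
Let D := r.+1.
Let Q := 16 * Dn.
Let K := 8 * D * Q.
Let E := 1024 * Dn ^ 2.

Lemma monochromatic_cycle : exists T0, forall (L R : finType) (col : L -> R -> nat)
      N sigma (m : nat -> nat),
    #|L| = N -> #|R| = N -> (forall u v, 1 <= col u v <= r) ->
    N <= Dn * sigma -> T0 <= sigma -> (forall i, 1 <= i <= r -> T0 <= m i) ->
    (forall k, 3 <= k <= r -> 2 * (\sum_(1 <= i < k) m i + sigma) <= m k) ->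
    \sum_(1 <= i < r.+1) m i + sigma <= N ->
  exists i p, [/\ 1 <= i <= r, uniq p, cycle (color_rel col i) p & size p = 2 * m i].
Proof.
have [T HT] := @weak_regularity D K E isT.
(* Clusters with fewer than tau vertices are discarded. *)
pose tau := K + 4 * T * Q.
(* [8 T] pays for the skeleton walks and the rounding in the reserves, [2 E T tau] for the discarded
   clusters. *)
exists (8 * T + 2 * E * T * tau + 8) => L R col N sigma m cL cR col1 leN lesig lem growth sumN.
have ltD u v : col u v < D by case/andP: (col1 u v).
have [I [J [P [S [cI cJ bad]]]]] := HT L R col ltD.
pose V i := P @^-1: [set i]; pose W j := S @^-1: [set j].
pose large i j := (tau <= #|V i|) && (tau <= #|W j|).
pose cc i j := if large i j then
  if [pick c : 'I_D | lreg col D K c (V i) (W j)] is Some c then val c else 0 else 0.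
pose col' u v := cc (P u) (S v).
pose e k : rel (I + J) := fun t t' => match t, t' with
  | inl i, inr j | inr j, inl i => (0 < k) && (cc i j == k) | _, _ => false end.
have K0 : 0 < K by rewrite /K /Q /D !muln_gt0 Dn0.
have sym_e k : symmetric (e k) by case=> ? [].
have ccP i j k : 0 < k -> cc i j = k ->
    [/\ tau <= #|V i|, tau <= #|W j| & lreg col D K k (V i) (W j)].
  rewrite /cc; case: ifP => [/andP[-> ->]|_ k0 E0]; last by rewrite -E0 in k0.
  by case: pickP => [c rc _ <-|_ k0 E0] //; rewrite -E0 in k0.
have den k t t' : e k t t' -> lower_dense (label P S) (color_rel col k) D K t t'.
  case: t t' => [i|j] [j'|i'] //= /andP[k0 /eqP E0]; have [_ _ rg] := ccP _ _ _ k0 E0.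
    by case: (lreg_lower_dense rg).
  by case: (lreg_lower_dense rg).
have big k t t' : e k t t' -> tau <= #|cluster (label P S) t|.
  case: t t' => [i|j] [j'|i'] //= /andP[k0 /eqP E0]; have [? ? _] := ccP _ _ _ k0 E0.
    by rewrite card_cluster_inl.
  by rewrite card_cluster_inr.
pose missing := \sum_u \sum_v (col' u v == 0).
have sN : sigma <= N by apply: leq_trans sumN; apply: leq_addl.
(* Colour 0 occurs on no edge of [col], so the strict inequality in [lreg] keeps it from being
   picked. *)
have good_pos i j : large i j -> good_pair D K col (V i) (W j) -> 0 < cc i j.
  rewrite /cc => lij; rewrite lij => /existsP good_ij.
  case: pickP => [c rc|nc]; last by case: good_ij => c; rewrite nc.
  rewrite lt0n; apply: contraTneq rc => /= ->.
  apply/forallPn; exists (V i); apply/forallPn; exists (W j).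
  rewrite !subxx !leq_pmull //= /ecount big1 ?muln0 // => u _.
  by rewrite big1 // => v _; case/andP: (col1 u v); case: (col u v).
have lemiss : E * missing <= 2 * N ^ 2.
  have lT : 2 * E * (T * tau) <= N.
    apply: leq_trans sN; apply: leq_trans lesig; rewrite mulnA; clear; lia.
  have : missing <= \sum_u \sum_v ((#|V (P u)| < tau) + ((#|W (S v)| < tau) +
      ~~ good_pair D K col (V (P u)) (W (S v)))).
    apply: leq_sum => u _; apply: leq_sum => v _.
    have [t1|] := ltnP #|V (P u)| tau; first by case: (_ == _).
    have [t2|] := ltnP #|W (S v)| tau; first by case: (_ == _).
    move=> t2 t1; case: (boolP (good_pair _ _ _ _ _)) => [gd|_]; last by case: (_ == _).
    by have := good_pos _ _ (introT andP (conj t1 t2)) gd; rewrite /col'; case: (cc _ _).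
  under eq_bigr do rewrite big_split big_split sum_nat_const /=.
  rewrite big_split big_split sum_nat_const /= -big_distrr /=.
  rewrite (sum_cells P S (fun i j => ~~ good_pair D K col (V i) (W j))).
  have sP := small_cells P tau; have sS := small_cells S tau.
  move/(leq_mul (leqnn E))/leq_trans; apply; rewrite cL cR in bad *.
  apply: (missing_count bad (leq_trans sP _) (leq_trans sS _) lT).
    by rewrite leq_mul2r cI orbT.
  by rewrite leq_mul2r cJ orbT.
have N0 : 0 < N by apply: leq_trans (leq_trans lesig sN); rewrite addnS.
(* Since [N <= Dn * sigma], this ensures [64 gam <= sigma]. *)
pose gam := N %/ (64 * Dn).
pose BL := [set u | gam < #|[set v | col' u v == 0]|].
pose BR := [set v | gam < #|[set u | col' u v == 0]|].
have ltN : N < gam.+1 * (64 * Dn) by rewrite ltn_ceil // muln_gt0.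
have cBL : 8 * #|BL| <= sigma.
  apply: few_bad_count ltN leN N0 Dn0; apply: leq_trans lemiss; rewrite mulnC leq_mul2l.
  by rewrite few_bad_vertices orbT.
have cBR : 8 * #|BR| <= sigma.
  apply: few_bad_count ltN leN N0 Dn0; apply: leq_trans lemiss; rewrite mulnC leq_mul2l.
  by rewrite /missing exchange_big (few_bad_vertices (fun v u => col' u v == 0)) orbT.
have sgam : 64 * gam <= sigma.
  have : gam * (64 * Dn) <= Dn * sigma by apply: leq_trans leN; apply: leq_trunc_div.
  by rewrite mulnA (mulnC gam) mulnC leq_pmul2l.
have Tsig : 8 * T + 8 <= sigma by apply: leq_trans lesig; rewrite leq_add2r leq_addr.
have reserve_le z i : Q * z <= 2 * N + Q * i -> i <= T -> 8 * z <= 2 * sigma.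
  move=> h iT; have : 16 * Dn * z <= Dn * (2 * sigma + 16 * T).
    by apply: leq_trans h _; move: leN iT; rewrite /Q; clear; nia.
  rewrite (mulnC 16) -mulnA leq_pmul2l //; move: Tsig; clear; lia.
(* Of the slack [sigma], the reserve takes at most a quarter and the bad vertices an eighth; what
   remains exceeds [8 gam]. *)
have card_rest (U : finType) (A B : {set U}) : #|U| = N -> 8 * #|~: A| <= 2 * sigma ->
    8 * #|B| <= sigma -> \sum_(1 <= i < r.+1) m i + (8 * gam).+1 <= #|A :\: B|.
  move=> cU cA cB; have := cardsC A; rewrite cU => cAC.
  have : #|A| <= #|A :\: B| + #|B|.
    by rewrite -[X in X <= _](cardsID B) addnC leq_add2l subset_leq_card ?subsetIr.
  move: cAC cA cB sumN sgam Tsig; move: #|~: A| #|A :\: B| #|A| #|B| (bigop.body _ _ _).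
  clear; lia.
have Q1 : 1 < Q by rewrite /Q; move: Dn0; clear; lia.
have [X0 [resX cX0]] := exists_reserve P Q1.
have [Y0 [resY cY0]] := exists_reserve S Q1.
pose X := X0 :\: BL; pose Y := Y0 :\: BR.
have cX : \sum_(1 <= i < r.+1) m i + (8 * gam).+1 <= #|X|.
  by apply: card_rest; rewrite // (reserve_le _ _ _ cI) // -{1}cL.
have cY : \sum_(1 <= i < r.+1) m i + (8 * gam).+1 <= #|Y|.
  by apply: card_rest; rewrite // (reserve_le _ _ _ cJ) // -{1}cR.
(* Classes are components of the cluster graph of colour [k], named by their canonical
   representatives. *)
pose kL k u := fingraph.root (e k) (inl (P u)); pose kR k v := fingraph.root (e k) (inr (S v)).
have [k u v E0 k0||||||||i [ir [M [mM cM [t HM]]]]] :=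
    @ramsey_matching L R (I + J)%type col' kL kR _ m (8 * gam).+1 gam r X Y.
- apply/(fingraph.rootP (sym_connect_sym (sym_e k))); apply: connect1.
  by rewrite /= k0 -E0 eqxx.
- exact: ltnSn.
- exact: r2.
- move=> k /growth; apply: leq_trans; rewrite leq_mul2l leq_add2l /=.
  by move: sgam Tsig; clear; lia.
- exact: cX.
- exact: cY.
- move=> u v _ _; rewrite /col' /cc; case: ifP => // _; case: pickP => // c _.
  by rewrite -ltnS ltn_ord.
- split=> [u|v].
    rewrite inE => /andP[uB _]; apply: leq_trans (_ : #|[set v | col' u v == 0]| <= _).
      by apply/subset_leq_card/subsetP=> v; rewrite !inE => /andP[].
    by move: uB; rewrite inE -leqNgt.
  rewrite inE => /andP[vB _]; apply: leq_trans (_ : #|[set u | col' u v == 0]| <= _).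
    by apply/subset_leq_card/subsetP=> u; rewrite !inE => /andP[].
  by move: vB; rewrite inE -leqNgt.
have i0 : 0 < i by case/andP: ir.
have lemi := lem i ir.
have Tmi : 8 * T + 8 <= m i by apply: leq_trans lemi; rewrite leq_add2r leq_addr.
have [|||w [cw sw cwL cwR]] := @matching_walk L R I J P S (e i) M t (sym_e i) mM.
- by rewrite cM; move: cI cJ Tmi; clear; lia.
- by rewrite cM; move: Tmi; clear; lia.
- by move=> p /HM[_ _ Ec kt]; split => //=; rewrite i0 -Ec eqxx.
(* All but [4 T] visits to a cluster are charged to matched vertices, which avoid the reserve. The
   reserve has a [2/Q] share and [tau >= 4 T Q], so a [1/Q] share stays unvisited. *)
have room (U : finType) (A B C : {set U}) n : tau <= #|A| -> 2 * #|A| <= Q * #|A :\: B| ->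
    C \subset A :&: B -> n <= 2 * (#|I| + #|J|) + #|C| -> #|A| <= Q * (#|A| - n).
  move=> lA resA /subset_leq_card sC le.
  have := cardsID B A; move: lA resA sC le; rewrite /tau.
  move: #|A :&: B| #|A :\: B| #|C| #|A| => a b c d lA resA ca le E0.
  have : Q * (b - 4 * T) <= Q * (d - n).
    by rewrite leq_mul2l; move: cI cJ le ca E0; clear; lia.
  by apply: leq_trans; rewrite mulnBr; move: lA resA; clear; nia.
have [||||p [up cp sp]] := @embed_cycle (L + R)%type (I + J)%type (label P S)
  (color_rel col i) D K Q
  (@color_rel_irr _ _ _ _) (@color_rel_sym _ _ _ _) isT _ _ _ w (sym_e i) (den i) cw.
- exact: ltnW.
- exact: leqnn.
- by rewrite sw cM; move: Tmi; clear; lia.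
- move=> t0 tw; have bt := big _ _ _ (next_cycle cw tw).
  split; first by apply: leq_trans bt; apply: leq_addr.
  case: t0 tw bt => [i'|j'] tw; rewrite ?card_cluster_inl ?card_cluster_inr => bt.
    apply: (room _ _ X0 _ _ bt (resX i') _ (cwL _ tw)).
    apply/subsetP=> u; rewrite !inE => /andP[/imsetP[p pM ->] ->].
    by case: (HM p pM) => /setDP[].
  apply: (room _ _ Y0 _ _ bt (resY j') _ (cwR _ tw)).
  apply/subsetP=> u; rewrite !inE => /andP[/imsetP[p pM ->] ->].
  by case: (HM p pM) => _ /setDP[].
by exists i, p; split => //; rewrite sp sw cM.
Qed.
End MonochromaticCycle.

(** * From cyclic sequences to copies of cycles *)

Lemma next_nth_mod (T : eqType) (d : T) (p : seq T) i : uniq p -> i < size p ->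
  next p (nth d p i) = nth d p (i.+1 %% size p).
Proof.
case: p => // a s us lt; rewrite next_nth mem_nth // index_uniq //.
move: lt; rewrite ltnS leq_eqVlt => /predU1P[->|lt].
  by rewrite modnn nth_default.
by rewrite modn_small //=; apply: set_nth_default.
Qed.

Lemma mono_copy_cycle (G : sgraph) (c : {set G} -> nat) k (p : seq G) :
  uniq p -> cycle (fun x y => adj x y && (c [set x; y] == k)) p ->
  mono_copy (Cycle (size p)) c k.
Proof.
move=> up cp; exists (tnth (in_tuple p)); split; first exact/tuple_uniqP.
have step (i : 'I_(size p)) : let x := tnth (in_tuple p) i in
    let y := tnth (in_tuple p) (ordS i) in adj x y /\ c [set x; y] = k.
  move=> x y; have := next_cycle cp (mem_tnth i (in_tuple p)); rewrite -/x => H.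
  suff -> : y = next p x by case/andP: H => ? /eqP.
  have d : G := x; by rewrite /y /x !(tnth_nth d) /= next_nth_mod.
move=> i j /andP[_ /orP[/eqP <-|/eqP <-]]; first exact: step.
by rewrite adj_sym setUC; apply: step.
Qed.

Lemma Knn_mono_cycle N0 N (leN : N0 <= N) (c : {set Knn N} -> nat) k m
    (p : seq ('I_N0 + 'I_N0)) :
  1 < m -> uniq p -> size p = 2 * m ->
  cycle (color_rel (fun u v => c [set inl (widen_ord leN u); inr (widen_ord leN v)]) k) p ->
  has_mono_cycle (2 * m) c k.
Proof.
move=> m1 up sp cp; split.
  rewrite -(leq_pmul2l (isT : 0 < 2)) in m1.
  by apply: leq_trans m1.
pose f (x : 'I_N0 + 'I_N0) : Knn N :=
  match x with inl u => inl (widen_ord leN u) | inr v => inr (widen_ord leN v) end.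
have fI : injective f.
  by case=> u [] v // [E]; congr (_ _); apply/val_inj.
rewrite -sp -(size_map f); apply: mono_copy_cycle; first by rewrite map_inj_uniq.
by apply: homo_cycle cp => -[u|v] [u'|v'] //=; rewrite setUC.
Qed.

(** * From real to integer parameters *)

Import Order.TTheory GRing.Theory Num.Theory.
Local Open Scope ring_scope.

Theorem theorem1p3 (R : realType) (r : nat) (xi : R) (alpha : nat -> R)
    (hr : (3 <= r)%N) (hxi : 0 < xi)
    (h1 : 0 < alpha 1%N) (h2 : 0 < alpha 2%N)
    (halpha : forall j : nat, (1 <= j <= r - 2)%N ->
       ((j + 2)`!%:R - 1) * (\sum_(1 <= i < (j + 1).+1) alpha i)
         <= alpha (j + 2)%N) :
  exists n0 : nat, forall n : nat, (n0 <= n)%N ->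
  forall N : nat,
    (\sum_(1 <= i < r.+1) alpha i + (r + 2)%:R * r`!%:R * xi) * n%:R
      <= N%:R ->
  forall c : {set Knn N} -> nat, edge_coloring r c ->
  exists i : nat, (1 <= i <= r)%N /\
    has_mono_cycle (2 * Num.truncn (alpha i * n%:R)%R)%N c i.
Proof.
(* The common slack per unit of [n]: it is at most [xi] and, by [kall], at most every [alpha i]. *)
pose k := Num.min xi (Num.min (alpha 1%N) (alpha 2%N)).
have k0 : 0 < k by rewrite !lt_min hxi h1 h2.
have [kxi k1 k2] : [/\ k <= xi, k <= alpha 1%N & k <= alpha 2%N].
  by rewrite /k !ge_min !lexx !orbT.
have base (j : nat) : (1 < j)%N -> (forall i, (1 <= i < j.+1)%N -> k <= alpha i) ->
    2 * k <= \sum_(1 <= i < j.+1) alpha i.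
  case: j => [|[|j]] // _ ki; rewrite big_ltn // big_ltn // addrA.
  have : 0 <= \sum_(3 <= i < j.+3) alpha i.
    rewrite big_nat; apply: sumr_ge0 => i /andP[i3 ij].
    by apply: le_trans (ltW k0) _; apply: ki; rewrite ij andbT; apply: leq_trans i3.
  by move: k1 k2; set s := \sum_(_ <= _ < _) _; lra.
(* For [j >= 3] the factor [j! - 1] is at least 5, and the sum [S] is at least [2 k], so
   [5 S >= 2 (S + k)]. *)
have step (j : nat) : (3 <= j <= r)%N ->
    (forall i, (1 <= i < j)%N -> k <= alpha i) ->
    2 * (\sum_(1 <= i < j) alpha i + k) <= alpha j.
  move=> /andP[j3 jr] ki; have := halpha (j - 2)%N.
  have -> : (j - 2 + 2)%N = j by rewrite subnK // ltnW.
  have -> : ((j - 2 + 1).+1 = j)%N by move: j3; clear; lia.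
  have -> : (1 <= j - 2 <= r - 2)%N by move: j3 jr; clear; lia.
  move/(_ isT); apply: le_trans.
  have := base j.-1; rewrite (ltn_predK j3) => /(_ _ ki) => bj.
  have {}bj : 2 * k <= \sum_(1 <= i < j) alpha i by apply: bj; move: j3; clear; lia.
  have f6 : (6 : R) <= j`!%:R.
    by rewrite (_ : 6 = 3`!%:R) // ler_nat leq_fact.
  move: bj f6 k0; set S := \sum_(_ <= _ < _) _; set F := _`!%:R; nra.
have kall i : (1 <= i <= r)%N -> k <= alpha i.
  elim/ltn_ind: i => -[|[|[|i]]] IH // ir.
  have {}IH i' : (1 <= i' < i.+3)%N -> k <= alpha i'.
    by move=> /andP[i0 lt]; apply: IH => //; rewrite i0 /=; move: lt ir; clear; lia.
  apply: le_trans (step i.+3 ir IH).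
  have := base i.+2 isT IH; move: k0; set S := \sum_(_ <= _ < _) _; lra.
have apos i : (1 <= i <= r)%N -> 0 <= alpha i by move/kall; apply: le_trans; apply: ltW.
set A := \sum_(1 <= i < r.+1) alpha i.
(* A bound for [N0 / sigma], from [N0 <= A n + sigma] and [k n < 2 sigma]; the added units cover the
   rounding and the summand [sigma]. *)
pose Dn := (Num.truncn (2 * A / k)).+2.
have [|//|T0 HT0] := @monochromatic_cycle r Dn; first exact: ltnW.
(* The summand 2 gives [sigma >= 2], hence [k n < 2 sigma] and cycles of length at least 4. *)
exists (Num.truncn ((T0 + 2)%:R / k)).+1 => n len N leN c hc.
have kn : (T0 + 2)%:R <= k * n%:R.
  rewrite mulrC -ler_pdivrMr //; apply: ltW; apply: lt_le_trans (truncnS_gt _) _.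
  by rewrite ler_nat.
have kn0 : 0 <= k * n%:R by apply: le_trans kn.
pose m i := Num.truncn (alpha i * n%:R); pose sigma := Num.truncn (k * n%:R).
have Tsig : (T0 + 2 <= sigma)%N by rewrite truncn_ge_nat.
have sigm i : (1 <= i <= r)%N -> (sigma <= m i)%N.
  by move=> /kall le; apply: le_truncn; apply: ler_wpM2r.
have sig_le : sigma%:R <= k * n%:R by rewrite truncn_le.
have summ j : (j <= r)%N ->
    (\sum_(1 <= i < j.+1) m i)%N%:R <= (\sum_(1 <= i < j.+1) alpha i) * n%:R.
  move=> jr; rewrite natr_sum mulr_suml [X in X <= _]big_nat [X in _ <= X]big_nat.
  apply: ler_sum => i /andP[i0 ij]; rewrite truncn_le mulr_ge0 //.
  by apply: apos; rewrite i0; apply: leq_trans jr.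
(* [N] has no upper bound in terms of [n], so the argument runs inside a complete bipartite subgraph
   whose side is at most [Dn * sigma]. *)
pose N0 := (\sum_(1 <= i < r.+1) m i + sigma)%N.
have leN0 : (N0 <= N)%N.
  rewrite -(ler_nat R); apply: le_trans leN; rewrite /N0 natrD mulrDl lerD ?summ //.
  apply: le_trans sig_le _; apply: ler_wpM2r => //; apply: le_trans kxi _.
  rewrite ler_peMl ?(ltW hxi) // -natrM ler1n muln_gt0 fact_gt0 andbT addnS //.
pose col (u v : 'I_N0) := c [set inl (widen_ord leN0 u); inr (widen_ord leN0 v)].
have [||||||i [p [ir up cp sp]]] := HT0 'I_N0 'I_N0 col N0 sigma m (card_ord N0) (card_ord N0).
- move=> u v; apply: hc; rewrite inE; apply/existsP; exists (inl (widen_ord leN0 u)).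
  by apply/existsP; exists (inr (widen_ord leN0 v)); rewrite /= eqxx.
- rewrite -(ler_nat R) natrM natrD.
  have := summ r (leqnn r); rewrite -/A.
  have Dk : 2 * A <= (Dn%:R - 1) * k.
    rewrite -ler_pdivrMr //; apply: ltW; apply: lt_le_trans (truncnS_gt _) _.
    by have <- : (Num.truncn (2 * A / k)).+1%:R + 1 = Dn%:R :> R := natr1 _; rewrite addrK.
  have sg : k * n%:R < 2 * sigma%:R.
    have : k * n%:R < sigma.+1%:R by apply: truncnS_gt.
    have : (2 : R) <= sigma%:R by rewrite ler_nat; apply: leq_trans Tsig; apply: leq_addl.
    by rewrite -natr1; lra.
  have n0R : 0 <= n%:R :> R by [].
  have D1 : 1 <= Dn%:R :> R by rewrite ler1n.
  have : (2 * A) * n%:R <= (Dn%:R - 1) * (k * n%:R) by rewrite mulrA ler_wpM2r.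
  have : (Dn%:R - 1) * (k * n%:R) <= (Dn%:R - 1) * (2 * sigma%:R) :> R.
    by rewrite ler_wpM2l ?subr_ge0 // ltW.
  lra.
- by apply: leq_trans Tsig; apply: leq_addr.
- by move=> i ir; apply: leq_trans (sigm i ir); apply: leq_trans Tsig; apply: leq_addr.
- move=> j /andP[j3 jr]; rewrite truncn_ge_nat; last first.
    by rewrite mulr_ge0 // apos // jr andbT; apply: leq_trans j3.
  have := step j; rewrite j3 jr => /(_ isT) st.
  have {}st : 2 * (\sum_(1 <= i < j) alpha i + k) <= alpha j.
    by apply: st => i /andP[i0 ij]; apply: kall; rewrite i0 /=; apply: leq_trans (ltnW ij) jr.
  have := summ j.-1; rewrite (ltn_predK j3) => sm.
  have {}sm := sm (leq_trans (leq_pred j) jr).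
  rewrite natrM natrD; apply: le_trans (_ : 2 * (\sum_(1 <= i < j) alpha i + k) * n%:R <= _).
    by rewrite -mulrA ler_pM2l // mulrDl lerD.
  by rewrite ler_wpM2r.
- exact: leqnn.
exists i; split => //; refine (@Knn_mono_cycle N0 N leN0 c i (m i) p _ up sp cp).
by apply: leq_trans (sigm i ir); apply: leq_trans Tsig; apply: leq_addl.
Qed.
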